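(* Consider the linear-Gaussian filtering model, the vanilla ensemble Kalman--Bucy filter estimator $\overline{U}^{N,l}_{t+k_1\Delta_l}(Y)$ and its limit $\overline{U}^{l}_{t+k_1\Delta_l}(Y)$ as defined in the context. Assume (i) $\mu(A)<0$, where $\mu(B)$ is the largest eigenvalue of $\tfrac12(B+B^{\top})$; and (ii) there is a finite constant bounding $|P^l_{k\Delta_l}(j_1,j_2)|$ uniformly over all $(k,l)\in\mathbb{N}_0^2$ and $(j_1,j_2)\in\{1,\dots,d_x\}^2$. Then for any $(l,t,k_1)\in\mathbb{N}_0\times\mathbb{N}_0\times\{0,1,\dots,\Delta_l^{-1}\}$, almost surely, $$\lim_{N\rightarrow\infty}\left[\overline{U}^{N,l}_{t+k_1\Delta_l}(Y)-\overline{U}^{l}_{t+k_1\Delta_l}(Y)\right]=0.$$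
   Context: Model. $(Y_t,X_t)\in\mathbb{R}^{d_y}\times\mathbb{R}^{d_x}$ satisfy $dY_t=CX_t\,dt+R^{1/2}dV_t$, $dX_t=AX_t\,dt+Q^{1/2}dW_t$, where $(V_t,W_t)$ is a $(d_y+d_x)$-dimensional standard Brownian motion, $A\in\mathbb{R}^{d_x\times d_x}$, $C\in\mathbb{R}^{d_y\times d_x}$, $R^{1/2},Q^{1/2}$ are square, symmetric and invertible, $Y_0=0$, and $X_0\sim\mathcal{N}_{d_x}(\mathcal{M}_0,\mathcal{P}_0)$ is independent of $(V,W)$. Put $S=C^{\top}R^{-1}C$ and $\mathrm{Ricc}(G)=AG+GA^{\top}-GSG+Q$. Discretization. For $l\in\mathbb{N}_0$, $\Delta_l=2^{-l}$. Define $m^l_0=\mathcal{M}_0$, $P^l_0=\mathcal{P}_0$ and $m^l_{(k+1)\Delta_l}=m^l_{k\Delta_l}+Am^l_{k\Delta_l}\Delta_l+P^l_{k\Delta_l}C^{\top}R^{-1}([Y_{(k+1)\Delta_l}-Y_{k\Delta_l}]-Cm^l_{k\Delta_l}\Delta_l)$, $P^l_{(k+1)\Delta_l}=P^l_{k\Delta_l}+\mathrm{Ricc}(P^l_{k\Delta_l})\Delta_l+(A-P^l_{k\Delta_l}S)P^l_{k\Delta_l}(A^{\top}-SP^l_{k\Delta_l})\Delta_l^2$. Vanilla ensemble Kalman--Bucy filter (Euler-discretized, $N\ge2$ particles): for $i\in\{1,\dots,N\}$, $k\in\mathbb{N}_0$, $$\xi^i_{(k+1)\Delta_l}=\xi^i_{k\Delta_l}+A\xi^i_{k\Delta_l}\Delta_l+Q^{1/2}[\overline{W}^i_{(k+1)\Delta_l}-\overline{W}^i_{k\Delta_l}]+P^N_{k\Delta_l}C^{\top}R^{-1}\Big([Y_{(k+1)\Delta_l}-Y_{k\Delta_l}]-\big[C\xi^i_{k\Delta_l}\Delta_l+R^{1/2}[\overline{V}^i_{(k+1)\Delta_l}-\overline{V}^i_{k\Delta_l}]\big]\Big),$$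 with $m^N_{k\Delta_l}=\frac1N\sum_i\xi^i_{k\Delta_l}$, $P^N_{k\Delta_l}=\frac1{N-1}\sum_i(\xi^i_{k\Delta_l}-m^N_{k\Delta_l})(\xi^i_{k\Delta_l}-m^N_{k\Delta_l})^{\top}$, where $\xi_0^i$ are i.i.d. $\mathcal{N}_{d_x}(\mathcal{M}_0,\mathcal{P}_0)$, $(\overline{W}^i,\overline{V}^i)$ are independent standard Brownian motions of dimensions $d_x,d_y$, and all of these are independent across $i$ and of $(X,Y)$. The systems for different $N$ are defined on a common probability space with the same $Y$. Estimators. $\overline{U}^{N,l}_{t+k_1\Delta_l}(Y)=\sum_{k=0}^{t\Delta_l^{-1}+k_1-1}[\langle Cm^N_{k\Delta_l},R^{-1}[Y_{(k+1)\Delta_l}-Y_{k\Delta_l}]\rangle-\frac{\Delta_l}{2}\langle m^N_{k\Delta_l},Sm^N_{k\Delta_l}\rangle]$, and $\overline{U}^{l}_{t+k_1\Delta_l}(Y)$ is the same expression with $m^N_{k\Delta_l}$ replaced by $m^l_{k\Delta_l}$. *)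

(* Defs.v *)
From HB Require Import structures.
From mathcomp Require Import all_boot all_order all_algebra.
From mathcomp Require Import all_classical all_reals all_analysis.

Set Implicit Arguments.
Unset Strict Implicit.
Unset Printing Implicit Defensive.

Import Order.TTheory GRing.Theory Num.Theory.
Import numFieldNormedType.Exports.

Local Open Scope classical_set_scope.
Local Open Scope ring_scope.

(* Vectors are column vectors; a process is a function of the time [t : R] and
   of the outcome, of which only the times [0 <= t] matter. Measurability is
   taken coordinatewise. *)

Definition mutual_independence (R : realType) (d : measure_display)
    (T : measurableType d) (P : probability T R) (I : eqType)
    (F : I -> set (set T)) : Prop :=
  forall (J : seq I) (E : I -> set T), uniq J ->
    (forall i, i \in J -> F i (E i)) ->
    P (\bigcap_(i in [set` J]) E i) = (\prod_(i <- J) P (E i))%E.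

Definition random_vector (R : realType) (d : measure_display)
    (T : measurableType d) (n : nat) (Z : T -> 'cV[R]_n) : Prop :=
  forall j, measurable_fun setT (fun w => Z w j 0).

Definition sigma_vector (R : realType) (T : Type) (n : nat)
    (Z : T -> 'cV[R]_n) : set (set T) :=
  <<s \bigcup_j preimage_set_system setT (fun w => Z w j 0) measurable >>.

Definition sigma_process (R : realType) (T : Type) (n : nat)
    (Z : R -> T -> 'cV[R]_n) : set (set T) :=
  <<s \bigcup_(tj in [set tj : R * 'I_n | 0 <= tj.1])
        preimage_set_system setT (fun w => Z tj.1 w tj.2 0) measurable >>.

Definition dotv (R : realType) (n : nat) (u v : 'cV[R]_n) : R :=
  (u^T *m v) 0 0.

(* The Dirac branch is needed because [normal_prob m 0] is not [\d_m]. *)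
Definition normal1 (R : realType) (m v : R) (B : set R) : \bar R :=
  if v == 0 then \d_m B else normal_prob m (Num.sqrt v) B.

(* N_n(m, G), possibly degenerate: every linear functional <u, Z> has law
   N(<u, m>, <u, G u>). *)
Record gaussian_vector (R : realType) (d : measure_display)
    (T : measurableType d) (P : probability T R) (n : nat)
    (Z : T -> 'cV[R]_n) (m : 'cV[R]_n) (G : 'M[R]_n) : Prop := {
  gaussian_random_vector : random_vector Z ;
  gaussian_cov_sym : G^T = G ;
  gaussian_cov_psd : forall u : 'cV[R]_n, 0 <= dotv u (G *m u) ;
  gaussian_law : forall (u : 'cV[R]_n) (B : set R), measurable B ->
    P ((fun w => dotv u (Z w)) @^-1` B)
      = normal1 (dotv u m) (dotv u (G *m u)) B
}.

Record brownian_motion (R : realType) (d : measure_display)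
    (T : measurableType d) (P : probability T R) (n : nat)
    (B : R -> T -> 'cV[R]_n) : Prop := {
  bm_random_vector : forall t : R, 0 <= t -> random_vector (B t) ;
  bm_start : {ae P, forall w, B 0 w = 0} ;
  bm_continuous :
    {ae P, forall w, {within `[0, +oo[, continuous (fun t => B t w)}} ;
  bm_increment : forall s t : R, 0 <= s -> s <= t ->
    gaussian_vector P (fun w => B t w - B s w) 0 (t - s)%:M ;
  bm_independent_increments : forall (n' : nat) (t : nat -> R), 0 <= t 0%N ->
    {homo t : i j / (i <= j)%N >-> i <= j} ->
    mutual_independence P
      (fun i : 'I_n' => sigma_vector (fun w => B (t i.+1) w - B (t i) w))
}.

(* [obs_sd] and [sig_sd] are R^{1/2} and Q^{1/2}. *)
Record lg_params (R : realType) (dx dy : nat) := LGParams {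
  drift : 'M[R]_dx ;
  obs : 'M[R]_(dy, dx) ;
  obs_sd : 'M[R]_dy ;
  sig_sd : 'M[R]_dx ;
  mean0 : 'cV[R]_dx ;
  cov0 : 'M[R]_dx
}.

Definition sig_cov (R : realType) (dx dy : nat) (M : lg_params R dx dy)
  : 'M[R]_dx := sig_sd M *m sig_sd M.

Definition obs_cov_inv (R : realType) (dx dy : nat) (M : lg_params R dx dy)
  : 'M[R]_dy := invmx (obs_sd M *m obs_sd M).

Definition Smx (R : realType) (dx dy : nat) (M : lg_params R dx dy)
  : 'M[R]_dx := (obs M)^T *m obs_cov_inv M *m obs M.

Definition Ricc (R : realType) (dx dy : nat) (M : lg_params R dx dy)
    (G : 'M[R]_dx) : 'M[R]_dx :=
  drift M *m G + G *m (drift M)^T - G *m Smx M *m G + sig_cov M.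

(* Largest eigenvalue of the symmetric part: the spectrum is finite, and
   nonempty for n > 0, so this supremum is a maximum. *)
Definition log_norm (R : realType) (n : nat) (B : 'M[R]_n) : R :=
  sup [set a : R | eigenvalue (2^-1 *: (B + B^T)) a].

Definition integral_vec (R : realType) (n : nat) (t : R) (f : R -> 'cV[R]_n)
  : 'cV[R]_n :=
  \col_j \int[lebesgue_measure]_(s in `[0, t]) f s j 0.

(* The noise is additive, so the two equations are integral equations holding
   pathwise; no stochastic integral is involved. *)
Record lg_model (R : realType) (d : measure_display) (T : measurableType d)
    (P : probability T R) (dx dy : nat) (M : lg_params R dx dy)
    (X : R -> T -> 'cV[R]_dx) (Y : R -> T -> 'cV[R]_dy)
    (W : R -> T -> 'cV[R]_dx) (V : R -> T -> 'cV[R]_dy) : Prop := {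
  lg_obs_sd_sym : (obs_sd M)^T = obs_sd M ;
  lg_obs_sd_unit : obs_sd M \in unitmx ;
  lg_sig_sd_sym : (sig_sd M)^T = sig_sd M ;
  lg_sig_sd_unit : sig_sd M \in unitmx ;
  lg_noise : brownian_motion P (fun t w => col_mx (V t w) (W t w)) ;
  lg_init : gaussian_vector P (X 0) (mean0 M) (cov0 M) ;
  lg_init_indep : mutual_independence P
    (fun b : bool => if b then sigma_vector (X 0)
                     else sigma_process (fun t w => col_mx (V t w) (W t w))) ;
  lg_signal_rv : forall t : R, 0 <= t -> random_vector (X t) ;
  lg_obs_rv : forall t : R, 0 <= t -> random_vector (Y t) ;
  lg_signal_continuous :
    {ae P, forall w, {within `[0, +oo[, continuous (fun t => X t w)}} ;
  lg_obs_continuous :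
    {ae P, forall w, {within `[0, +oo[, continuous (fun t => Y t w)}} ;
  lg_obs_start : {ae P, forall w, Y 0 w = 0} ;
  lg_signal_eq : {ae P, forall w, forall t : R, 0 <= t ->
    X t w = X 0 w + integral_vec t (fun s => drift M *m X s w)
            + sig_sd M *m W t w} ;
  lg_obs_eq : {ae P, forall w, forall t : R, 0 <= t ->
    Y t w = Y 0 w + integral_vec t (fun s => obs M *m X s w)
            + obs_sd M *m V t w}
}.

(* In the recursions below the index [k] stands for the time
   [k%:R * Delta R l], and the driving paths are arbitrary functions of time. *)

Definition Delta (R : realType) (l : nat) : R := 2 ^- l.

Definition incr (R : realType) (n l : nat) (f : R -> 'cV[R]_n) (k : nat)
  : 'cV[R]_n := f (k.+1%:R * Delta R l) - f (k%:R * Delta R l).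

Fixpoint kb_cov (R : realType) (dx dy : nat) (M : lg_params R dx dy)
    (l k : nat) : 'M[R]_dx :=
  if k is k'.+1 then
    let G := kb_cov M l k' in
    G + Delta R l *: Ricc M G
      + (Delta R l) ^+ 2 *:
          ((drift M - G *m Smx M) *m G *m ((drift M)^T - Smx M *m G))
  else cov0 M.

Fixpoint kb_mean (R : realType) (dx dy : nat) (M : lg_params R dx dy)
    (l : nat) (y : R -> 'cV[R]_dy) (k : nat) : 'cV[R]_dx :=
  if k is k'.+1 then
    let m := kb_mean M l y k' in
    m + Delta R l *: (drift M *m m)
      + kb_cov M l k' *m (obs M)^T *m obs_cov_inv M
          *m (incr l y k' - Delta R l *: (obs M *m m))
  else mean0 M.

Definition sample_mean (R : realType) (n N : nat) (z : 'I_N -> 'cV[R]_n)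
  : 'cV[R]_n := N%:R^-1 *: \sum_i z i.

Definition sample_cov (R : realType) (n N : nat) (z : 'I_N -> 'cV[R]_n)
  : 'M[R]_n :=
  (N%:R - 1)^-1 *:
    \sum_i (z i - sample_mean z) *m (z i - sample_mean z)^T.

Fixpoint enkbf (R : realType) (dx dy : nat) (M : lg_params R dx dy) (l N : nat)
    (y : R -> 'cV[R]_dy) (z0 : 'I_N -> 'cV[R]_dx)
    (wb : 'I_N -> R -> 'cV[R]_dx) (vb : 'I_N -> R -> 'cV[R]_dy)
    (k : nat) : 'I_N -> 'cV[R]_dx :=
  if k is k'.+1 then
    let z := enkbf M l y z0 wb vb k' in
    fun i =>
      z i + Delta R l *: (drift M *m z i) + sig_sd M *m incr l (wb i) k'
        + sample_cov z *m (obs M)^T *m obs_cov_inv M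
            *m (incr l y k'
                - (Delta R l *: (obs M *m z i)
                   + obs_sd M *m incr l (vb i) k'))
  else z0.

Definition enkbf_mean (R : realType) (dx dy : nat) (M : lg_params R dx dy)
    (l N : nat) (y : R -> 'cV[R]_dy) (z0 : 'I_N -> 'cV[R]_dx)
    (wb : 'I_N -> R -> 'cV[R]_dx) (vb : 'I_N -> R -> 'cV[R]_dy)
    (k : nat) : 'cV[R]_dx := sample_mean (enkbf M l y z0 wb vb k).

Definition ensemble_sigma (R : realType) (T : Type) (dx dy N : nat)
    (X : R -> T -> 'cV[R]_dx) (Y : R -> T -> 'cV[R]_dy)
    (xi0 : 'I_N -> T -> 'cV[R]_dx) (Wb : 'I_N -> R -> T -> 'cV[R]_dx)
    (Vb : 'I_N -> R -> T -> 'cV[R]_dy)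
    (s : option ('I_N + 'I_N + 'I_N)) : set (set T) :=
  match s with
  | None => sigma_process (fun t w => col_mx (X t w) (Y t w))
  | Some (inl (inl i)) => sigma_vector (xi0 i)
  | Some (inl (inr i)) => sigma_process (Wb i)
  | Some (inr i) => sigma_process (Vb i)
  end.

Record ensemble_noise (R : realType) (d : measure_display)
    (T : measurableType d) (P : probability T R) (dx dy : nat)
    (M : lg_params R dx dy) (X : R -> T -> 'cV[R]_dx) (Y : R -> T -> 'cV[R]_dy)
    (N : nat) (xi0 : 'I_N -> T -> 'cV[R]_dx)
    (Wb : 'I_N -> R -> T -> 'cV[R]_dx) (Vb : 'I_N -> R -> T -> 'cV[R]_dy)
    : Prop := {
  ens_init : forall i, gaussian_vector P (xi0 i) (mean0 M) (cov0 M) ;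
  ens_sig_bm : forall i, brownian_motion P (Wb i) ;
  ens_obs_bm : forall i, brownian_motion P (Vb i) ;
  ens_indep : mutual_independence P (ensemble_sigma X Y xi0 Wb Vb)
}.

Definition Ubar (R : realType) (dx dy : nat) (M : lg_params R dx dy) (l : nat)
    (y : R -> 'cV[R]_dy) (m : nat -> 'cV[R]_dx) (n : nat) : R :=
  \sum_(0 <= k < n)
    (dotv (obs M *m m k) (obs_cov_inv M *m incr l y k)
     - Delta R l / 2 * dotv (m k) (Smx M *m m k)).

(* Main.v *)
Require Import Defs.
From mathcomp Require Import all_boot all_order all_algebra.
From mathcomp Require Import all_classical all_reals all_analysis.
From mathcomp Require Import measurable_realfun ring lra.
Set Implicit Arguments.
Unset Strict Implicit.
Unset Printing Implicit Defensive.
Import Order.TTheory GRing.Theory Num.Theory.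
Import numFieldNormedType.Exports.
Local Open Scope classical_set_scope.
Local Open Scope ring_scope.

(** The ensemble enters its own recursion through its sample covariance alone:
    given [sample_cov] at step [k], the next ensemble is an affine image, with
    the same coefficients for all particles, of the present ensemble and of the
    Brownian increments of step [k]. Sample means and sample cross-covariances
    respect affine maps exactly, without any expectation being taken. Along a
    fixed observation path, convergence of the filter is therefore a
    deterministic consequence of one fact about the noises: as [N] grows, the
    sample means and the sample cross-covariances of the initial states and of
    all increments tend to their expectations. In the limit the covariance
    recursion reads
      [trans G * G * trans G ^T + Delta * Q + Delta * G S G],
    with [trans G = 1 + Delta * (A - G S)], and expanding this product gives the
    recursion of [kb_cov], the term in [Delta ^ 2] included ([kb_cov_step]).
    This induction is [enkbf_cvg], and the estimator is a continuous function of
    finitely many means ([Ubar_cvg]).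

    The fact about the noises is a strong law of large numbers, but for a
    triangular array: the ensembles of different sizes need not be related, so
    almost sure convergence has to come from summable tail bounds and the
    Borel-Cantelli lemma. A term of an empirical second moment is a product of
    two Gaussian variables [A] and [B], and
      [exp (e * |A B|) <= exp (e * A ^ 2) + exp (e * B ^ 2)]
    has a finite expectation for small [e]. Hence its moment generating
    function is at most [1 + c s + C s ^ 2] near [0], where [c] is the mean and
    [C] depends neither on [N] nor on the particle; Chernoff's bound then
    decreases geometrically in [N] ([as_cvg_of_exp_moment], [lln_rows]).

    Independence is used twice. Between particles it factorizes the moment
    generating function of a row sum; since one particle uses three of the
    independent sigma-algebras, this goes through the independence of disjoint
    groups of sigma-algebras ([indep_groups], [ge0_expectation_prod_groups]).
    Within a particle it makes the covariance of two different noises vanish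
    ([noise_indep], [noise_cross_moment]). *)

(** * Bounds on the exponential and the square root *)

Section real_bounds.
Variable R : realType.
Implicit Types x y s a c d : R.

(** A linear function of [s] that is dominated by [s ^ 2] on both sides of [0] is
    zero. This is how a mean is read off an inequality between moment generating
    functions, without differentiating under the integral. *)
Lemma eq0_of_quadratic_bound a c d : 0 < d ->
  (forall s, `|s| <= d -> s * a <= c * s ^+ 2) -> a = 0.
Proof.
move=> d0 H.
have c0 : 0 <= c.
  have h1 := H d; have h2 := H (- d).
  rewrite normrN gtr0_norm// lexx in h1 h2.
  have : 0 <= c * d ^+ 2.
    by have := h1 isT; have := h2 isT; rewrite sqrrN mulNr; lra.
  by rewrite pmulr_lge0// exprn_gt0.
apply/eqP/negP => /negP a0.
have an : 0 < `|a| by rewrite normr_gt0.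
pose e := Num.min d (`|a| / (2 * (c + 1))).
have e0 : 0 < e by rewrite lt_min d0 divr_gt0//; lra.
have ed : e <= d by rewrite ge_min lexx.
have ea : e * (2 * (c + 1)) <= `|a|.
  by rewrite -ler_pdivlMr; [rewrite ge_min lexx orbT|lra].
have := H (Num.sg a * e).
rewrite normrM normr_sg a0 mul1r gtr0_norm// => /(_ ed).
rewrite exprMn sqr_sg a0 mul1r mulrAC -normrEsg => h.
have : e * `|a| <= e * (c * e) by lra.
rewrite ler_pM2l// => h'.
have : 0 <= c * e by rewrite mulr_ge0// ltW.
lra.
Qed.

Lemma expR_le_quadratic y : expR y <= 1 + y + y ^+ 2 * expR `|y|.
Proof.
have h1 : expR y <= 1 + y * expR y.
  have := expR_ge1Dx (- y); rewrite expRN.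
  have := expR_gt0 y; move: (expR y) => e e0 h.
  have : (1 - y) * e <= e^-1 * e by rewrite ler_pM2r.
  rewrite mulVf ?gt_eqF//; lra.
have h2 := expR_ge1Dx y.
have [y0|y0] := leP 0 y.
  rewrite ger0_norm//; nra.
have h3 : 1 <= expR `|y| by rewrite -[leLHS]expR0 ler_expR.
have : y * (expR y - 1) <= y ^+ 2 by nra.
have := sqr_ge0 y; nra.
Qed.

(** Taylor bound for [expR (s * x)] whose remainder is of order [s ^ 2], uniformly
    in [s], times an exponential of [`|x|] with a fixed rate: half of the rate
    [s0] absorbs [expR `|s * x|], the other half absorbs [x ^ 2]. *)
Lemma expR_le_quadratic_scaled s0 s x : 0 < s0 -> `|s| <= s0 / 2 ->
  expR (s * x) <= 1 + s * x + 8 / s0 ^+ 2 * s ^+ 2 * expR (s0 * `|x|).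
Proof.
move=> s00 hs; apply: (le_trans (expR_le_quadratic _)); rewrite lerD2l.
have hx : (s0 * `|x| / 2) ^+ 2 / 2 <= expR (s0 * `|x| / 2).
  have := @expR_ge1Dxn R (s0 * `|x| / 2) 1.
  rewrite mulr_ge0 ?mulr_ge0 ?(ltW s00)// => /(_ isT).
  by rewrite (_ : 2`!%:R = 2 :> R)//; move: (_ * _ / 2) => z; lra.
have e2 : expR (s0 * `|x|) = expR (s0 * `|x| / 2) ^+ 2.
  by rewrite -expRM_natl; congr expR; lra.
have e3 : expR `|s * x| <= expR (s0 * `|x| / 2).
  by rewrite ler_expR normrM mulrAC ler_wpM2r.
rewrite e2 exprMn.
have -> : 8 / s0 ^+ 2 * s ^+ 2 * expR (s0 * `|x| / 2) ^+ 2
   = s ^+ 2 * (8 / s0 ^+ 2 * expR (s0 * `|x| / 2) ^+ 2) by ring.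
rewrite -[leLHS]mulrA ler_wpM2l ?sqr_ge0//.
have hx' : x ^+ 2 <= 8 / s0 ^+ 2 * expR (s0 * `|x| / 2).
  rewrite -(ler_pM2l (x := s0 ^+ 2 / 8)); last by rewrite divr_gt0 ?exprn_gt0.
  rewrite [leRHS](_ : _ = expR (s0 * `|x| / 2)); last first.
    by field; rewrite gt_eqF.
  apply: le_trans hx; rewrite -(real_normK (num_real x)); lra.
apply: (le_trans (ler_wpM2r (expR_ge0 _) hx')).
rewrite [in leRHS]expr2 [leRHS]mulrA ler_wpM2l//.
by rewrite mulr_ge0 ?expR_ge0// divr_ge0// sqr_ge0.
Qed.

Lemma invsqrt_le_quadratic x : `|x| <= 2^-1 ->
  (Num.sqrt (1 - x))^-1 <= 1 + x / 2 + x ^+ 2.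
Proof.
rewrite ler_norml => /andP[x1 x2].
have q0 : 0 < 1 + x / 2 + x ^+ 2 by have := sqr_ge0 x; lra.
have r0 : 0 < 1 - x by lra.
have rs : 0 < Num.sqrt (1 - x) by rewrite sqrtr_gt0.
rewrite -[leLHS]mul1r ler_pdivrMr//.
rewrite -(@ler_pXn2r _ 2)// ?nnegrE ?mulr_ge0 ?(ltW q0) ?(ltW rs)//.
rewrite expr1n exprMn sqr_sqrtr ?(ltW r0)//.
have h : 0 <= x ^+ 2 * (5 / 4 - 5 / 4 * x - x ^+ 3).
  rewrite mulr_ge0 ?sqr_ge0//.
  have : x ^+ 3 <= 1/4.
    have [x0|x0] := leP 0 x; last by rewrite exprS; have := sqr_ge0 x; nra.
    have : x ^+ 3 <= 2^-1 ^+ 3 by rewrite lerXn2r ?nnegrE.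
    by rewrite !exprS expr0; lra.
  lra.
have -> : (1 + x / 2 + x ^+ 2) ^+ 2 * (1 - x)
   = 1 + x ^+ 2 * (5 / 4 - 5 / 4 * x - x ^+ 3) by field.
by rewrite lerDl.
Qed.

End real_bounds.

(** * Moments of the normal law *)

Section gauss.
Variable R : realType.
Local Notation mu := (@lebesgue_measure R).
Implicit Types (m v s : R).

(** The density of [normal_prob] with respect to the Lebesgue measure, as a
    formula for integrals: it agrees almost everywhere with the Radon-Nikodym
    derivative, for which the change of variables holds. *)
Lemma integral_normal_prob m s (f : R -> \bar R) :
  (forall x, 0 <= f x)%E -> measurable_fun setT f ->
  (\int[normal_prob m s]_x f x = \int[mu]_x (f x * (normal_pdf m s x)%:E))%E.
Proof.
move=> f0 mf.
have dom := normal_prob_dominates m s.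
have h1 : measurable_fun setT (Radon_Nikodym_SigmaFinite.f (normal_prob m s) mu).
  apply: measurable_int; exact: Radon_Nikodym_SigmaFinite.f_integrable.
have h2 : measurable_fun setT (fun x => (normal_pdf m s x)%:E).
  by apply/measurable_EFinP; exact: measurable_normal_pdf.
rewrite -(Radon_Nikodym_SigmaFinite.change_of_variables dom)//.
apply: ae_eq_integral => //.
- exact: emeasurable_funM.
- exact: emeasurable_funM.
- apply: ae_eqe_mul2l; apply: integral_ae_eq => //.
    exact: Radon_Nikodym_SigmaFinite.f_integrable.
  by move=> E _ mE; rewrite -Radon_Nikodym_SigmaFinite.f_integral.
Qed.

(** Completing the square: an exponential weight translates the normal density. *)
Lemma normal_pdf_tilt m s k x : s != 0 ->
  expR (k * (x - m)) * normal_pdf m s x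
  = expR (k ^+ 2 * s ^+ 2 / 2) * normal_pdf (m + k * s ^+ 2) s x.
Proof.
move=> s0; rewrite !normal_pdfE// /normal_fun !(mulrCA _ (normal_peak s)).
congr (_ * _); rewrite -!expRD; congr expR.
by field.
Qed.

(** A weight that is the exponential of a square rescales the normal density, as
    long as the total quadratic exponent remains negative. *)
Lemma normal_pdf_sqtilt m s k x : 0 < s -> 2 * k * s ^+ 2 < 1 ->
  let q := Num.sqrt (1 - 2 * k * s ^+ 2) in
  expR (k * (x - m) ^+ 2) * normal_pdf m s x
  = q^-1 * normal_pdf m (s / q) x.
Proof.
move=> s0 ks q.
have q0 : 0 < q by rewrite sqrtr_gt0 subr_gt0.
have qE : q ^+ 2 = 1 - 2 * k * s ^+ 2 by rewrite sqr_sqrtr// subr_ge0 ltW.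
rewrite !normal_pdfE ?gt_eqF ?divr_gt0// /normal_fun mulrCA [RHS]mulrA.
congr (_ * _).
  rewrite /normal_peak.
  have -> : (s / q) ^+ 2 * pi *+ 2 = (s ^+ 2 * pi *+ 2) * (q^-1) ^+ 2.
    by field; rewrite gt_eqF.
  rewrite sqrtrM; last by rewrite mulrn_wge0// mulr_ge0 ?sqr_ge0 ?pi_ge0.
  rewrite sqrtr_sqr ger0_norm ?invr_ge0 ?ltW// invfM invrK mulrCA mulVf ?mulr1//.
  by rewrite gt_eqF.
rewrite -expRD; congr expR.
have -> : (s / q) ^+ 2 = s ^+ 2 / (1 - 2 * k * s ^+ 2).
  by rewrite exprMn exprVn qE.
field; rewrite (gt_eqF s0) andbT gt_eqF// subr_gt0//.
Qed.


Lemma integral_normal_tilt m s k : 0 < s ->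
  (\int[normal_prob m s]_x (expR (k * (x - m)))%:E
   = (expR (k ^+ 2 * s ^+ 2 / 2))%:E)%E.
Proof.
move=> s0; rewrite integral_normal_prob//; last first.
  apply/measurable_EFinP; apply: measurableT_comp => //.
  by apply: measurable_funM => //; exact: measurable_funB.
under eq_integral do rewrite -EFinM normal_pdf_tilt ?gt_eqF// EFinM.
rewrite ge0_integralZl ?integral_normal_pdf ?mule1 ?lee_fin ?expR_ge0//.
- by apply/measurable_EFinP; exact: measurable_normal_pdf.
- by move=> x _; rewrite lee_fin normal_pdf_ge0.
Qed.

Lemma integral_normal_sqtilt m s k : 0 < s -> 2 * k * s ^+ 2 < 1 ->
  (\int[normal_prob m s]_x (expR (k * (x - m) ^+ 2))%:E
   = ((Num.sqrt (1 - 2 * k * s ^+ 2))^-1)%:E)%E.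
Proof.
move=> s0 ks; rewrite integral_normal_prob//; last first.
  apply/measurable_EFinP; apply: measurableT_comp => //.
  apply: measurable_funM => //; apply: measurable_funX.
  exact: measurable_funB.
under eq_integral do rewrite -EFinM normal_pdf_sqtilt// EFinM.
rewrite ge0_integralZl ?integral_normal_pdf ?mule1 ?lee_fin ?invr_ge0 ?sqrtr_ge0//.
- by apply/measurable_EFinP; exact: measurable_normal_pdf.
- by move=> x _; rewrite lee_fin normal_pdf_ge0.
Qed.
End gauss.

Section exp_moments.
Context d (T : measurableType d) (R : realType) (P : probability T R).
Implicit Types (X Y : T -> R).
Local Open Scope ereal_scope.

Lemma measurable_expRM (s : R) Y : measurable_fun setT Y ->
  measurable_fun setT (fun w => (expR (s * Y w))%:E).
Proof.
move=> mY; apply/measurable_EFinP; apply: measurableT_comp => //.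
exact: measurable_funM.
Qed.

Lemma integrable_expR (s : R) Y : measurable_fun setT Y ->
  \int[P]_w (expR (s * Y w))%:E < +oo ->
  P.-integrable setT (fun w => (expR (s * Y w))%:E).
Proof.
move=> mY h; apply/integrableP; split; first exact: measurable_expRM.
by under eq_integral do rewrite gee0_abs ?lee_fin ?expR_ge0//.
Qed.

Lemma integrable_of_exp_moment (s : R) Y : (0 < s)%R -> measurable_fun setT Y ->
  \int[P]_w (expR (s * Y w))%:E < +oo ->
  \int[P]_w (expR (- s * Y w))%:E < +oo ->
  P.-integrable setT (EFin \o Y).
Proof.
move=> s0 mY h1 h2.
have i1 := integrable_expR mY h1; have i2 := integrable_expR mY h2.
apply: (@le_integrable _ _ _ P _ measurableT _
  (fun w => (s^-1)%:E * ((expR (s * Y w))%:E + (expR (- s * Y w))%:E))) => //.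
- exact/measurable_EFinP.
- move=> w _ /=. rewrite lee_fin.
  rewrite [leRHS]ger0_norm; last first.
    by rewrite mulr_ge0 ?addr_ge0 ?expR_ge0// invr_ge0 ltW.
  rewrite -(ler_pM2l s0) mulVKf ?gt_eqF//.
  have := expR_ge1Dx (s * Y w); have := expR_ge1Dx (- s * Y w).
  have := expR_ge0 (s * Y w); have := expR_ge0 (- s * Y w).
  rewrite mulNr -[(s in (s * `|_|)%R)](gtr0_norm s0) -normrM.
  by case: ler0P; lra.
- by apply: integrableZl => //; exact: integrableD.
Qed.

(** Since [1 + s * y <= expR (s * y)], an upper bound on the moment generating
    function whose linear term is [b * s] forces the mean to be [b], as [s] may
    have either sign. *)
Lemma expectation_of_exp_moment (e b c : R) Y : (0 < e)%R ->
  measurable_fun setT Y ->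
  (forall s : R, (`|s| <= e)%R ->
     \int[P]_w (expR (s * Y w))%:E <= (1 + b * s + c * s ^+ 2)%:E) ->
  P.-integrable setT (EFin \o Y) /\ \int[P]_w (Y w)%:E = b%:E.
Proof.
move=> e0 mY h.
have iY : P.-integrable setT (EFin \o Y).
  by apply: (integrable_of_exp_moment e0) => //; apply: le_lt_trans (ltry _);
    apply: h; rewrite ?normrN gtr0_norm.
split=> //.
have fY : \int[P]_w (Y w)%:E \is a fin_num by exact: integrable_fin_num iY.
rewrite -(fineK fY); congr (_%:E).
set y := fine _; apply/eqP; rewrite -subr_eq0; apply/eqP.
apply: (@eq0_of_quadratic_bound _ _ c e) => // s se.
have : (1 + s * y)%:E <= (1 + b * s + c * s ^+ 2)%:E.
  apply: le_trans (h s se); rewrite EFinD EFinM fineK//.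
  have e1 : \int[P]_w (1%:E : \bar R) = 1%:E.
    by rewrite integral_cst//= probability_setT mule1.
  rewrite -integralZl// -[X in X + _]e1 -integralD//=.
  - apply: le_integral => //.
    + apply: integrableD => //; last exact: integrableZl.
      exact: finite_measure_integrable_cst.
    + by apply: integrable_expR => //; apply: le_lt_trans (h s se) (ltry _).
    + by move=> w _ /=; rewrite -?EFinM -EFinD lee_fin expR_ge1Dx.
  - exact: finite_measure_integrable_cst.
  - exact: integrableZl.
by rewrite lee_fin; lra.
Qed.

End exp_moments.

(** An exponent for which the square of a variable of law [normal1 m v] has an
    exponential moment, together with a bound on this moment. Both are explicit
    functions of [m] and [v], so that they are the same for all particles. *)
Definition sq_rate (R : realType) (v : R) : R := (4 * (1 + v))^-1 / 2.

Definition sq_bound (R : realType) (m v : R) : R :=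
  let e := (4 * (1 + v))^-1 in
  expR (e * m ^+ 2) * (1 + v * e + 4 * v ^+ 2 * e ^+ 2).

Section normal_law.
Context d (T : measurableType d) (R : realType) (P : probability T R).
Variables (X : T -> R) (m v : R).
Hypothesis mX : measurable_fun setT X.
Hypothesis v0 : 0 <= v.
Hypothesis lawX : forall B, measurable B -> P (X @^-1` B) = normal1 m v B.

Lemma integral_normal1 (f : R -> \bar R) : (forall x, 0 <= f x)%E ->
  measurable_fun setT f ->
  (\int[P]_w f (X w) =
   if (v == 0)%R then f m else \int[normal_prob m (Num.sqrt v)]_x f x)%E.
Proof.
move=> f0 mf.
have mX' : @measurable_fun _ _ T (measurableTypeR R) setT X by exact: mX.
have mf' : @measurable_fun _ _ (measurableTypeR R) _ setT f by exact: mf.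
pose X' : {RV P >-> measurableTypeR R} :=
  @mfun_Sub _ _ T (measurableTypeR R) _ (mem_set mX').
rewrite -[LHS](ge0_integral_distribution X')//.
case: ifPn => v0'.
  rewrite (eq_measure_integral (@dirac _ (measurableTypeR R) m R)).
    by rewrite integral_dirac// diracT mul1e.
  by move=> A mA _; rewrite /= /distribution /pushforward lawX// /normal1 v0'.
apply: (eq_measure_integral (normal_prob m (Num.sqrt v))) => A mA _.
by rewrite /= /distribution /pushforward lawX// /normal1 (negbTE v0').
Qed.

Lemma normal1_mgf k :
  (\int[P]_w (expR (k * (X w - m)))%:E = (expR (k ^+ 2 * v / 2))%:E)%E.
Proof.
rewrite (@integral_normal1 (fun x => (expR (k * (x - m)))%:E)); last 2 first.
- by move=> x; rewrite lee_fin expR_ge0.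
- apply/measurable_EFinP; apply: measurableT_comp => //.
  by apply: measurable_funM => //; exact: measurable_funB.
have [->|vn] := eqVneq v 0; first by rewrite subrr !mulr0 mul0r.
by rewrite integral_normal_tilt ?sqr_sqrtr// sqrtr_gt0 lt_neqAle eq_sym vn.
Qed.

Lemma normal1_sqmgf k : 2 * k * v < 1 ->
  (\int[P]_w (expR (k * (X w - m) ^+ 2))%:E
   = ((Num.sqrt (1 - 2 * k * v))^-1)%:E)%E.
Proof.
move=> kv.
rewrite (@integral_normal1 (fun x => (expR (k * (x - m) ^+ 2))%:E)); last 2 first.
- by move=> x; rewrite lee_fin expR_ge0.
- apply/measurable_EFinP; apply: measurableT_comp => //.
  by apply: measurable_funM => //; apply: measurable_funX; exact: measurable_funB.
have [->|vn] := eqVneq v 0.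
  by rewrite subrr expr0n/= !mulr0 expR0 subr0 sqrtr1 invr1.
by rewrite integral_normal_sqtilt ?sqr_sqrtr// sqrtr_gt0 lt_neqAle eq_sym vn.
Qed.

Lemma normal1_mean :
  P.-integrable setT (EFin \o X) /\ (\int[P]_w (X w)%:E = m%:E)%E.
Proof.
have mXm : measurable_fun setT (fun w => X w - m) by exact: measurable_funB.
have e0 : 0 < (1 + v)^-1 by rewrite invr_gt0 ltr_pwDl.
have [i1 i2] : P.-integrable setT (EFin \o (fun w => X w - m)) /\
    (\int[P]_w (X w - m)%:E = 0%:E)%E.
  apply: (@expectation_of_exp_moment _ _ _ P _ 0 (v / 2 * (1 + expR 1)) _ e0) => //.
  move=> s hs; rewrite normal1_mgf lee_fin mul0r addr0.
  have v1 : 0 < 1 + v by rewrite ltr_pwDl.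
  have s1 : `|s| * (1 + v) <= 1 by rewrite -ler_pdivlMr ?div1r.
  have s2 : s ^+ 2 = `|s| ^+ 2 by rewrite real_normK ?num_real.
  have y1 : s ^+ 2 * v / 2 <= 1.
    have n0 := normr_ge0 s; rewrite s2 expr2.
    have nv : 0 <= `|s| * v by rewrite mulr_ge0.
    have : `|s| * (`|s| * v) <= 1 * 1 by apply: ler_pM => //; lra.
    lra.
  have y0 : 0 <= s ^+ 2 * v / 2.
    by apply: divr_ge0 => //; apply: mulr_ge0 => //; exact: sqr_ge0.
  apply: (le_trans (expR_le_quadratic _)).
  rewrite [X in _ <= 1 + X](_ : _ =
    s ^+ 2 * v / 2 + (s ^+ 2 * v / 2) * expR 1); last by field.
  rewrite -addrA lerD2l lerD2l expr2 -mulrA ler_wpM2l//.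
  rewrite -[leRHS]mul1r ler_pM ?expR_ge0// ler_expR ger0_norm//.
have -> : X = (fun w => (X w - m) + m) by apply/funext => w; rewrite subrK.
have ic : P.-integrable setT (EFin \o cst m) by exact: finite_measure_integrable_cst.
split.
  exact: (@integrableD _ _ _ P setT _ _ _ i1 ic).
under eq_integral do rewrite EFinD.
by rewrite integralD//= i2 add0e integral_cst//= probability_setT mule1.
Qed.

Let e := (4 * (1 + v))^-1.

Lemma normal1_sqmgf_le k : `|k| <= e ->
  (\int[P]_w (expR (k * (X w - m) ^+ 2))%:E
   <= (1 + v * k + 4 * v ^+ 2 * k ^+ 2)%:E)%E.
Proof.
move=> ke.
have v1 : 0 < 4 * (1 + v) by rewrite mulr_gt0// ltr_pwDl.
have kv : `|k| * (4 * (1 + v)) <= 1 by rewrite -ler_pdivlMr ?div1r.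
have kv2 : `|2 * k * v| <= 2^-1.
  rewrite !normrM (ger0_norm v0) ger0_norm//.
  have nv : 0 <= `|k| * v by rewrite mulr_ge0.
  have := normr_ge0 k; lra.
rewrite normal1_sqmgf; last by move: kv2; rewrite ler_norml; lra.
rewrite lee_fin; apply: le_trans (invsqrt_le_quadratic kv2) _; lra.
Qed.

Let e0 : 0 < e. Proof. by rewrite invr_gt0 mulr_gt0// ltr_pwDl. Qed.

Let mXm2 : measurable_fun setT (fun w => (X w - m) ^+ 2).
Proof. by apply: measurable_funX; exact: measurable_funB. Qed.

(** The moment generating function of [(X - m) ^ 2] is [(1 - 2 k v) ^ (- 1 / 2)],
    whose expansion at [0] begins with [1 + v k]. *)
Lemma normal1_variance :
  P.-integrable setT (EFin \o (fun w => (X w - m) ^+ 2)) /\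
  (\int[P]_w ((X w - m) ^+ 2)%:E = v%:E)%E.
Proof.
apply: (@expectation_of_exp_moment _ _ _ P e v (4 * v ^+ 2)) => //.
exact: normal1_sqmgf_le.
Qed.

Lemma normal1_second_moment :
  P.-integrable setT (EFin \o (fun w => X w ^+ 2)) /\
  (\int[P]_w (X w ^+ 2)%:E = (m ^+ 2 + v)%:E)%E.
Proof.
have [i1 e1] := normal1_variance; have [i2 e2] := normal1_mean.
have ic : P.-integrable setT (EFin \o cst (- m ^+ 2)).
  exact: finite_measure_integrable_cst.
have E1 w : (X w ^+ 2)%:E = (((X w - m) ^+ 2)%:E + ((2 * m)%:E * (X w)%:E
     + (- m ^+ 2)%:E))%E.
  by rewrite -!EFinM -!EFinD; congr EFin; ring.
have iZ : P.-integrable setT (fun w => (2 * m)%:E * (X w)%:E)%E.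
  exact: integrableZl.
have iD : P.-integrable setT (fun w => (2 * m)%:E * (X w)%:E + (- m ^+ 2)%:E)%E.
  exact: integrableD.
split.
  rewrite (_ : EFin \o _ = fun w => (((X w - m) ^+ 2)%:E
    + ((2 * m)%:E * (X w)%:E + (- m ^+ 2)%:E))%E); last exact/funext.
  exact: (@integrableD _ _ _ P setT _ _ _ i1 iD).
under eq_integral do rewrite E1.
rewrite integralD//= e1 integralD//= integralZl//= e2.
rewrite integral_cst//= probability_setT mule1 -EFinM -!EFinD; congr EFin; ring.
Qed.

Lemma normal1_exp_square :
  (\int[P]_w (expR (sq_rate v * X w ^+ 2))%:E <= (sq_bound m v)%:E)%E.
Proof.
have me : measurable_fun setT (fun w => (expR (e * (X w - m) ^+ 2))%:E).
  by apply/measurable_EFinP; apply: measurableT_comp => //; exact: measurable_funM.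
have mX2 : measurable_fun setT (fun w => X w ^+ 2) by exact: measurable_funX.
rewrite /sq_rate /sq_bound -/e.
apply: (@le_trans _ _ (\int[P]_w ((expR (e * m ^+ 2))%:E
    * (expR (e * (X w - m) ^+ 2))%:E))%E).
  apply: ge0_le_integral => //.
  - exact: (measurable_expRM (e / 2) mX2).
  - exact: measurable_funeM.
  - move=> w _; rewrite -EFinM lee_fin -expRD ler_expR -mulrDr.
    rewrite -mulrA ler_wpM2l ?(ltW e0)//.
    by have := sqr_ge0 (X w - m - m); nra.
rewrite ge0_integralZl//.
rewrite EFinM lee_wpmul2l ?lee_fin ?expR_ge0//.
by apply: normal1_sqmgf_le; rewrite gtr0_norm.
Qed.

End normal_law.

(** * A strong law from exponential moments *)

Section slln.
Context d (T : measurableType d) (R : realType) (P : probability T R).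

(** Chernoff's bound. With [C * s <= eps / 2] the quadratic term of the moment
    generating function costs at most half of the gain [s * eps]. *)
Lemma upper_tail_exp (S : T -> R) (N : nat) (s c C eps : R) :
  measurable_fun setT S -> 0 < s -> C * s <= eps / 2 ->
  (\int[P]_w (expR (s * S w))%:E <= ((1 + c * s + C * s ^+ 2) ^+ N)%:E)%E ->
  0 <= 1 + c * s + C * s ^+ 2 ->
  (P [set w | ((c + eps) * N%:R <= S w)%R] <= (expR (- (s * eps / 2)) ^+ N)%:E)%E.
Proof.
move=> mS s0 Cs hS p0.
pose X : {RV P >-> R} := mfun_Sub (mem_set mS).
have := @chernoff _ _ _ P X s ((c + eps) * N%:R) s0.
move=> /le_trans; apply.
have -> : 'M_P X s = (\int[P]_w (expR (s * S w))%:E)%E.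
  rewrite /mmt_gen_fun unlock; apply: eq_integral => w _ /=.
  by rewrite mulrC.
apply: (le_trans (lee_wpmul2r _ hS)); first by rewrite lee_fin expR_ge0.
rewrite -EFinM lee_fin.
have -> : expR (- (s * ((c + eps) * N%:R))) = expR (- (s * (c + eps))) ^+ N.
  by rewrite -expRM_natl; congr expR; ring.
rewrite -exprMn lerXn2r ?nnegrE ?mulr_ge0 ?expR_ge0//.
have := expR_ge1Dx (c * s + C * s ^+ 2); rewrite addrA => h.
apply: (le_trans (ler_wpM2r (expR_ge0 _) h)).
rewrite -expRD ler_expR.
have : s * (C * s) <= s * (eps / 2) by rewrite ler_wpM2l ?(ltW s0).
by rewrite expr2; lra.
Qed.

(** Strong law of large numbers for arbitrarily coupled sums: [S N] is only
    constrained through its own law, by the bound that a sum of [N] independent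
    variables of mean [c] satisfies. The tails are geometric in [N], so the
    Borel-Cantelli lemma applies. The rows with fewer than two terms are left
    free because an ensemble has at least two particles. *)
Lemma as_cvg_of_exp_moment (S : nat -> T -> R) (e c C : R) : 0 < e ->
  (forall N, (2 <= N)%N -> measurable_fun setT (S N)) ->
  (forall N s, (2 <= N)%N -> `|s| <= e ->
    (\int[P]_w (expR (s * S N w))%:E <= ((1 + c * s + C * s ^+ 2) ^+ N)%:E)%E) ->
  {ae P, forall w, (fun N => N%:R^-1 * S N w) @ \oo --> c}.
Proof.
move=> e0 mS hS.
suff H (eps : R) : 0 < eps -> {ae P, forall w,
    exists n0, forall N, (n0 <= N)%N -> `|N%:R^-1 * S N w - c| < eps}.
  have : {ae P, forall w, forall p : nat,
      exists n0, forall N, (n0 <= N)%N -> `|N%:R^-1 * S N w - c| < p.+1%:R^-1}.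
    by apply/ae_foralln => p; apply: H; rewrite invr_gt0.
  apply: filterS => w hw; apply/cvgrPdist_lt => eps eps0.
  have [p hp] : exists p : nat, p.+1%:R^-1 < eps.
    exists (Num.truncn eps^-1); rewrite invf_plt ?posrE//.
    by rewrite truncnS_gt.
  have [n0 hn0] := hw p; exists n0 => // N /= nN.
  by rewrite distrC; apply: lt_trans (hn0 _ nN) hp.
move=> eps0.
pose D := 1 + `|C|.
have D0 : 0 < D by rewrite ltr_wpDr.
(* Small enough for the hypothesis to apply, for Chernoff's bound to gain, and
   for the base of the power to be nonnegative. *)
pose s := Num.min e (Num.min (eps / 2 / D) (Num.min 1 ((2 * (`|c| + D))^-1))).
have s0 : 0 < s.
  rewrite !lt_min e0 ltr01 !divr_gt0//= invr_gt0 mulr_gt0// ltr_wpDl//.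
have se : s <= e by rewrite ge_min lexx.
have sD : s * D <= eps / 2 by rewrite -ler_pdivlMr// !ge_min lexx orbT.
have s1 : s <= 1 by rewrite !ge_min lexx !orbT.
have cD0 : 0 < 2 * (`|c| + D) by rewrite mulr_gt0// ltr_wpDl.
have scD : s * (2 * (`|c| + D)) <= 1.
  by rewrite -ler_pdivlMr// div1r !ge_min lexx !orbT.
have Cs : C * s <= eps / 2.
  apply: le_trans sD; rewrite mulrC ler_wpM2l ?(ltW s0)// /D.
  by have := ler_norm C; lra.
have Cs' : - C * - s <= eps / 2 by rewrite mulrNN.
have quad (t : R) : `|t| = s -> 0 <= 1 + c * t + C * t ^+ 2.
  move=> ts.
  have h1 : - (`|c| * s) <= c * t.
    by rewrite -ts -normrM; have := ler_norm (- (c * t)); rewrite normrN; lra.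
  have h2 : - (`|C| * s) <= C * t ^+ 2.
    have : `|C * t ^+ 2| <= `|C| * s.
      rewrite normrM normrX ts ler_wpM2l// expr2 ler_piMr// ltW//.
    by have := ler_norm (- (C * t ^+ 2)); rewrite normrN; lra.
  by move: scD; rewrite /D; lra.
pose rho := expR (- (s * eps / 2)).
pose F N := if (2 <= N)%N then
  [set w | (c + eps) * N%:R <= S N w] `|` [set w | (- c + eps) * N%:R <= - S N w]
  else set0.
have mF N : measurable (F N).
  rewrite /F; case: ifPn => // N2; apply: measurableU.
    rewrite -[X in measurable X]setTI; apply: measurable_fun_le => //; exact: mS.
  rewrite -[X in measurable X]setTI; apply: measurable_fun_le => //.
  by apply: measurable_funN; exact: mS.
have PF N : (P (F N) <= (2 * rho ^+ N)%:E)%E.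
  rewrite /F; case: ifPn => [N2|_]; last first.
    by rewrite measure0 lee_fin mulr_ge0// exprn_ge0// expR_ge0.
  apply: (le_trans (measureU2 _ _ _)).
  - rewrite -[X in measurable X]setTI; apply: measurable_fun_le => //; exact: mS.
  - rewrite -[X in measurable X]setTI; apply: measurable_fun_le => //.
    by apply: measurable_funN; exact: mS.
  rewrite mulr_natl mulr2n EFinD; apply: leeD.
    apply: (@upper_tail_exp _ _ _ _ C) => //; first exact: mS.
      by apply: hS => //; rewrite gtr0_norm.
    by apply: quad; rewrite gtr0_norm.
  apply: (@upper_tail_exp _ _ _ _ C) => //; first by apply: measurable_funN; exact: mS.
    have := hS N (- s) N2; rewrite normrN gtr0_norm// => /(_ se).
    rewrite sqrrN mulrN mulNr; under eq_integral do rewrite mulNr -mulrN; exact.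
  by have := quad (- s); rewrite normrN gtr0_norm// sqrrN mulrN mulNr; exact.
have sumF : (\sum_(n <oo) P (F n) < +oo)%E.
  have rho1 : `|rho| < 1.
    by rewrite ger0_norm ?expR_ge0// expR_lt1 oppr_lt0 divr_gt0// mulr_gt0.
  apply: (@le_lt_trans _ _ (\sum_(n <oo) (2 * rho ^+ n)%:E)%E).
    by apply: lee_nneseries => // n _; exact: PF.
  have cvg2 := @is_cvg_geometric_series R 2 rho rho1.
  rewrite (_ : (fun n => _) = EFin \o series (geometric 2 rho)).
    by rewrite EFin_lim// ltry.
  by apply/funext => n /=; rewrite /series/= sumEFin.
have := lim_sup_set_cvg0 mF sumF => null.
exists (lim_sup_set F); split => //.
- by apply: bigcap_measurable => // k _; apply: bigcup_measurable => j _; exact: mF.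
- move=> w /=; apply: contra_notP.
  rewrite /lim_sup_set => /existsNP[n /not_implyP[_ hn]].
  exists (maxn n 2) => N; rewrite geq_max => /andP[nN N2].
  have nF : ~ F N w by move=> FN; apply: hn; exists N.
  have N0 : (0 : R) < N%:R by rewrite ltr0n; apply: leq_trans N2.
  move: nF; rewrite /F N2 => /not_orP[/negP h1 /negP h2].
  rewrite -!ltNge in h1 h2.
  rewrite ltr_norml -(ltr_pM2r N0) -[in X in _ && X](ltr_pM2r N0).
  rewrite mulrBl mulrAC mulVf ?gt_eqF// mul1r.
  apply/andP; split; lra.
Qed.
End slln.

(** * Independence of groups of sigma-algebras *)

Section pi_lambda.
Context d (T : measurableType d) (R : realType) (P : probability T R).
Implicit Types (A B : set T) (G : set (set T)).
Local Open Scope ereal_scope.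

(** The sets [A] that are independent of [B] form a Dynkin system, which
    contains the sigma-algebra generated by a pi-system as soon as it contains
    this pi-system. *)
Lemma indep_sigma_algebra_l G B : setI_closed G -> G `<=` measurable ->
  measurable B -> (forall A, G A -> P (A `&` B) = P A * P B) ->
  forall A, <<s G >> A -> P (A `&` B) = P A * P B.
Proof.
move=> GI Gm mB GB A.
suff : <<s G >> `<=` [set A | measurable A /\ P (A `&` B) = P A * P B].
  by move=> /[apply] -[].
rewrite -setI_closed_g_dynkin_g_sigma_algebra//.
apply: smallest_sub; last by move=> C GC; split; [exact: Gm|exact: GB].
split.
- by split=> //; rewrite setTI probability_setT mul1e.
- move=> C [mC PC]; split; first exact: measurableC.
  rewrite probability_setC// muleBl ?fin_num_measure//.
  rewrite mul1e -PC [in RHS]setIC -measureD//; last by rewrite ltey_eq fin_num_measure.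
  by rewrite setDE setIC.
- move=> F tF HF; split; first by apply: bigcup_measurable => k _; exact: (HF k).1.
  rewrite setI_bigcupl measure_bigcup//; last 2 first.
  + by move=> k _; apply: measurableI => //; exact: (HF k).1.
  + exact: trivIset_setIr.
  rewrite [X in _ = X * _]measure_bigcup//; last by move=> k _; exact: (HF k).1.
  rewrite muleC -(@fineK _ (P B)) ?fin_num_measure// -nneseriesZl//.
  by apply: eq_eseriesr => k _ /=; rewrite (HF k).2 fineK ?fin_num_measure// muleC.
Qed.

Lemma sub_gen_measurable G : G `<=` measurable -> <<s G >> `<=` measurable.
Proof. by apply: smallest_sub; exact: sigma_algebra_measurable. Qed.

Lemma indep_sigma_algebra G1 G2 : setI_closed G1 -> setI_closed G2 ->
  G1 `<=` measurable -> G2 `<=` measurable ->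
  (forall A B, G1 A -> G2 B -> P (A `&` B) = P A * P B) ->
  forall A B, <<s G1 >> A -> <<s G2 >> B -> P (A `&` B) = P A * P B.
Proof.
move=> I1 I2 m1 m2 h A B sA sB.
apply: (@indep_sigma_algebra_l G1) => //; first exact: (sub_gen_measurable m2).
move=> C GC; rewrite setIC muleC; apply: (@indep_sigma_algebra_l G2) => //.
  exact: m1.
by move=> D GD; rewrite setIC muleC; exact: h.
Qed.

Lemma setI_closed_sigma G : setI_closed <<s G >>.
Proof.
move=> A B sA sB; pose G' : set (set (g_sigma_algebraType G)) := <<s G >>.
exact: (@measurableI _ (g_sigma_algebraType G)).
Qed.

Section groups.
Variables (I : eqType) (F : I -> set (set T)).

Definition group_sigma (J : seq I) : set (set T) :=
  <<s \bigcup_(i in [set` J]) F i >>.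

Lemma group_sigma_sub J1 J2 : {subset J1 <= J2} ->
  group_sigma J1 `<=` group_sigma J2.
Proof.
move=> J12; apply: sub_sigma_algebra2; apply: bigcup_subset => i /=; exact: J12.
Qed.

Hypothesis FI : forall i, setI_closed (F i).
Hypothesis FT : forall i, F i setT.
Hypothesis Fm : forall i, F i `<=` measurable.
Hypothesis Find : mutual_independence P F.

Let cyl (J : seq I) : set (set T) :=
  [set A | exists2 E : I -> set T, (forall i, i \in J -> F i (E i)) &
    A = \bigcap_(i in [set` J]) E i].

Let cylI J : setI_closed (cyl J).
Proof.
move=> _ _ [E1 h1 ->] [E2 h2 ->]; exists (fun i => E1 i `&` E2 i).
  by move=> i iJ; apply: FI; [exact: h1|exact: h2].
by rewrite bigcapI.
Qed.

Let cylm J : cyl J `<=` measurable.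
Proof.
move=> _ [E h ->]; apply: fin_bigcap_measurable; first exact: finite_seq.
by move=> i /= iJ; apply: (@Fm i); exact: h.
Qed.

Let cylE J : group_sigma J `<=` <<s cyl J >>.
Proof.
apply: sub_sigma_algebra2 => A [i /= iJ FA].
exists (fun j => if j == i then A else setT).
  by move=> j jJ; case: eqP => [->//|_]; exact: FT.
apply/seteqP; split => [w Aw j /= jJ|w /(_ i iJ)]; last by rewrite eqxx.
by case: ifP.
Qed.

(** The finite intersections of members of the [F i], [i \in J], form a pi-system
    that generates [group_sigma J], and mutual independence gives the product
    rule on two such pi-systems. *)
Lemma indep_groups (J1 J2 : seq I) : uniq (J1 ++ J2) ->
  forall A B, group_sigma J1 A -> group_sigma J2 B -> P (A `&` B) = P A * P B.
Proof.
move=> uJ A B /cylE sA /cylE sB.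
apply: (indep_sigma_algebra (@cylI J1) (@cylI J2)) => //.
move: uJ; rewrite cat_uniq => /and3P[u1 /hasPn d12 u2].
move=> _ _ [E1 h1 ->] [E2 h2 ->].
(* The two families of events are glued into one, to which mutual independence
   applies. *)
pose E i := if i \in J1 then E1 i else E2 i.
have e1 : {in J1, E =1 E1} by move=> i iJ; rewrite /E iJ.
have e2 : {in J2, E =1 E2} by move=> i /d12 /= /negbTE iJ; rewrite /E iJ.
have -> : \bigcap_(i in [set` J1]) E1 i = \bigcap_(i in [set` J1]) E i.
  by apply: eq_bigcapr => i /= iJ; rewrite e1.
have -> : \bigcap_(i in [set` J2]) E2 i = \bigcap_(i in [set` J2]) E i.
  by apply: eq_bigcapr => i /= iJ; rewrite e2.
rewrite -bigcap_setU.
have -> : [set` J1] `|` [set` J2] = [set` J1 ++ J2].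
  by apply/seteqP; split => i /=; rewrite mem_cat => /orP.
rewrite Find; last 2 first.
- by rewrite cat_uniq u1 u2 andbT; apply/hasPn.
- move=> i; rewrite mem_cat => /orP[] iJ.
    by rewrite e1//; exact: h1.
  by rewrite e2//; exact: h2.
rewrite big_cat/= !Find// => i iJ.
  by rewrite e2//; exact: h2.
by rewrite e1//; exact: h1.
Qed.

End groups.
End pi_lambda.

(** * Expectations of products of independent variables *)

Definition indep_rv d (T : measurableType d) (R : realType)
    (P : probability T R) (f g : T -> R) :=
  forall A B : set R, measurable A -> measurable B ->
  (P ((f @^-1` A) `&` (g @^-1` B)) = P (f @^-1` A) * P (g @^-1` B))%E.

Section indep_pair.
Context d (T : measurableType d) (R : realType) (P : probability T R).
Variables (f g : T -> R).
Hypothesis mf : measurable_fun setT f.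
Hypothesis mg : measurable_fun setT g.
Hypothesis ind : indep_rv P f g.
Local Open Scope ereal_scope.

Let X : {RV P >-> R} := mfun_Sub (mem_set mf).
Let Y : {RV P >-> R} := mfun_Sub (mem_set mg).
Let mXY : measurable_fun setT (fun w => (f w, g w)).
Proof. exact: measurable_fun_pair. Qed.
Let XY : {RV P >-> (R * R)%type} := mfun_Sub (mem_set mXY).

Let mabs : measurable_fun [set: R] (fun y : R => `|y|%:E).
Proof. by apply/measurable_EFinP; exact: normr_measurable. Qed.

Let lawXY (A : set (R * R)) : measurable A ->
  (distribution P X \x distribution P Y) A = distribution P XY A.
Proof.
move=> mA; apply: product_measure_unique => [B C mB mC|//]; exact: ind.
Qed.

(** By uniqueness of product measures, the joint law of [(f, g)] is the product of
    the two laws; the identity is then Tonelli's theorem. *)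
Lemma ge0_expectationM_indep : (forall w, (0 <= f w)%R) ->
  (forall w, (0 <= g w)%R) ->
  \int[P]_w (f w * g w)%:E = (\int[P]_w (f w)%:E) * (\int[P]_w (g w)%:E).
Proof.
move=> f0 g0.
have mh : measurable_fun setT (fun z : R * R => `|z.1|%:E * `|z.2|%:E).
  apply: emeasurable_funM; apply/measurable_EFinP; apply: measurableT_comp => //.
transitivity (\int[P]_w (`|f w|%:E * `|g w|%:E)).
  by apply: eq_integral => w _; rewrite EFinM !ger0_norm.
rewrite -(ge0_integral_distribution XY (f := fun z => `|z.1|%:E * `|z.2|%:E))//.
rewrite (eq_measure_integral (distribution P X \x distribution P Y)); last first.
  by move=> A mA _; exact/esym/lawXY.
rewrite fubini_tonelli1//= /fubini_F/=.
under eq_integral => x _.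
  rewrite ge0_integralZl//=.
  rewrite (ge0_integral_distribution Y (f := fun y => `|y|%:E))//.
  over.
rewrite ge0_integralZr//=; last by apply: integral_ge0 => w _; rewrite lee_fin.
rewrite (ge0_integral_distribution X (f := fun y => `|y|%:E))//.
by congr (_ * _); apply: eq_integral => w _ /=; rewrite ger0_norm.
Qed.


Lemma integral_indep_pair (h : R -> R -> R) :
  measurable_fun setT (fun z : R * R => h z.1 z.2) ->
  P.-integrable setT (fun w => (h (f w) (g w))%:E) ->
  \int[P]_w (h (f w) (g w))%:E
  = \int[distribution P X]_x \int[distribution P Y]_y (h x y)%:E.
Proof.
move=> mh hi.
have mh' : measurable_fun setT (fun z : R * R => (h z.1 z.2)%:E).
  exact/measurable_EFinP.
have hi' : (distribution P X \x distribution P Y).-integrable setT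
    (fun z : R * R => (h z.1 z.2)%:E).
  apply/integrableP; split => //.
  rewrite (eq_measure_integral (distribution P XY)); last first.
    by move=> A mA _; exact: lawXY.
  rewrite (ge0_integral_distribution XY)//; last exact: measurableT_comp.
  by move/integrableP : hi => [].
rewrite -(@integral_distribution _ _ _ _ _ P XY _ mh')//.
rewrite (eq_measure_integral (distribution P X \x distribution P Y)); last first.
  by move=> A mA _; exact/esym/lawXY.
by rewrite -integral12_prod_meas1.
Qed.

End indep_pair.

Section expectationM.
Context d (T : measurableType d) (R : realType) (P : probability T R).
Variables (f g : T -> R).
Hypothesis mf : measurable_fun setT f.
Hypothesis mg : measurable_fun setT g.
Hypothesis ind : indep_rv P f g.
Hypothesis fi : P.-integrable setT (EFin \o f).
Hypothesis gi : P.-integrable setT (EFin \o g).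
Local Open Scope ereal_scope.

Lemma integrableM_indep : P.-integrable setT (EFin \o (f \* g)%R).
Proof.
have mn (A : set R) : measurable A -> measurable ((fun x : R => `|x|%R) @^-1` A).
  by move=> mA; rewrite -[X in measurable X]setTI; exact: normr_measurable.
have indn : indep_rv P (fun w => `|f w|%R) (fun w => `|g w|%R).
  by move=> A B mA mB; exact: (ind (mn A mA) (mn B mB)).
apply/integrableP; split.
  by apply/measurable_EFinP; exact: measurable_funM.
under eq_integral do rewrite /= normrM.
rewrite ge0_expectationM_indep//; try exact: measurableT_comp.
apply: lte_mul_pinfty.
- by apply: integral_ge0 => w _; rewrite lee_fin.
- by apply: integrable_fin_num => //; exact: (integrable_norm fi).
- by move/integrableP : gi => [].
Qed.

Lemma expectationM_indep :
  \int[P]_w (f w * g w)%:E = (\int[P]_w (f w)%:E) * (\int[P]_w (g w)%:E).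
Proof.
have mid : measurable_fun [set: R] (fun x : R => x%:E) by exact/measurable_EFinP.
rewrite (@integral_indep_pair _ _ _ P f g mf mg ind (fun x y => x * y)%R)//; last 2 first.
- exact: measurable_funM.
- exact: integrableM_indep.
set X := mfun_Sub _; set Y := mfun_Sub _.
have iX : (distribution P X).-integrable setT (fun x : R => x%:E).
  exact: integrable_pushforward.
have iY : (distribution P Y).-integrable setT (fun x : R => x%:E).
  exact: integrable_pushforward.
have EY : \int[distribution P Y]_y (y%:E) = \int[P]_w (g w)%:E.
  by rewrite (@integral_distribution _ _ _ _ _ P Y _ mid).
have EX : \int[distribution P X]_y (y%:E) = \int[P]_w (f w)%:E.
  by rewrite (@integral_distribution _ _ _ _ _ P X _ mid).
under eq_integral => x _.
  under eq_integral do rewrite EFinM.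
  rewrite integralZl//= EY.
  over.
have gf : \int[P]_w (g w)%:E \is a fin_num by exact: integrable_fin_num gi.
by rewrite -(fineK gf) integralZr//= EX.
Qed.

End expectationM.

Section prod_groups.
Context d (T : measurableType d) (R : realType) (P : probability T R).
Local Open Scope ereal_scope.

Definition sub_measurable (G : set (set T)) (f : T -> R) :=
  @measurable_fun _ _ (g_sigma_algebraType G) R setT f.

Lemma sub_measurableP (G : set (set T)) (f : T -> R) (B : set R) :
  sub_measurable G f -> measurable B -> <<s G >> (f @^-1` B).
Proof.
by move=> mf mB; have := mf measurableT B mB; rewrite setTI.
Qed.

Lemma sub_measurable_sub (G G' : set (set T)) (f : T -> R) :
  <<s G >> `<=` <<s G' >> -> sub_measurable G f -> sub_measurable G' f.
Proof.
move=> GG' mf _ B mB; rewrite setTI; apply: GG'; exact: sub_measurableP.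
Qed.

Variables (I : eqType) (F : I -> set (set T)).
Hypothesis FI : forall i, setI_closed (F i).
Hypothesis FT : forall i, F i setT.
Hypothesis Fm : forall i, F i `<=` measurable.
Hypothesis Find : mutual_independence P F.

Lemma sub_measurableT (J : seq I) (f : T -> R) :
  sub_measurable (\bigcup_(i in [set` J]) F i) f -> measurable_fun setT f.
Proof.
move=> mf _ B mB; rewrite setTI.
apply: (@sub_gen_measurable _ _ (\bigcup_(i in [set` J]) F i)).
  by move=> A [i _]; exact: Fm.
exact: sub_measurableP.
Qed.

(** The variable [f k] may depend on several of the independent sigma-algebras,
    those indexed by [g k]; the [g k] are pairwise disjoint. Each step of the
    induction separates one group from the union of the remaining ones. *)
Lemma ge0_expectation_prod_groups (K : eqType) (g : K -> seq I) (f : K -> T -> R)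
    (s : seq K) : uniq (flatten (map g s)) ->
  (forall k, sub_measurable (\bigcup_(i in [set` g k]) F i) (f k)) ->
  (forall k w, (0 <= f k w)%R) ->
  \int[P]_w (\prod_(k <- s) f k w)%:E = \prod_(k <- s) \int[P]_w (f k w)%:E.
Proof.
move=> us mf f0; elim: s us => [_|k s IH] /=.
  rewrite big_nil; under eq_integral do rewrite big_nil.
  by rewrite integral_cst//= probability_setT mule1.
move=> us; have us' : uniq (flatten (map g s)).
  by move: us; rewrite cat_uniq => /and3P[].
rewrite big_cons -IH//.
have mk : measurable_fun setT (f k) by apply: sub_measurableT (mf k).
have ms : sub_measurable (\bigcup_(i in [set` flatten (map g s)]) F i)
    (fun w => (\prod_(k <- s) f k w)%R).
  apply: measurable_prod => k' ks.
  apply: sub_measurable_sub (mf k').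
  apply: (@group_sigma_sub _ T _ F (g k')) => i ig.
  by apply/flattenP; exists (g k') => //; exact: map_f.
under eq_integral do rewrite big_cons.
apply: ge0_expectationM_indep => //; first exact: sub_measurableT ms.
  move=> A B mA mB; apply: (indep_groups FI FT Fm Find us).
    exact: sub_measurableP (mf k) mA.
  exact: sub_measurableP ms mB.
by move=> w; apply: prodr_ge0.
Qed.

End prod_groups.

(** * A strong law for rows of independent variables *)

Section lln_rows.
Context d (T : measurableType d) (R : realType) (P : probability T R).

(** The constants depend on [Z] only through its mean and one exponential
    moment, hence are common to all the terms of an array. *)
Lemma mgf_le_quadratic (Z : T -> R) (e K c s : R) : 0 < e ->
  measurable_fun setT Z -> (\int[P]_w (expR (e * `|Z w|))%:E <= K%:E)%E ->
  P.-integrable setT (EFin \o Z) -> (\int[P]_w (Z w)%:E = c%:E)%E ->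
  `|s| <= e / 2 ->
  (\int[P]_w (expR (s * Z w))%:E <= (1 + c * s + 8 / e ^+ 2 * K * s ^+ 2)%:E)%E.
Proof.
move=> e0 mZ hK iZ Zc se.
have maZ : measurable_fun setT (fun w => `|Z w|) by exact: measurableT_comp.
have iE : P.-integrable setT (fun w => (expR (e * `|Z w|))%:E).
  by apply: integrable_expR => //; apply: le_lt_trans hK (ltry _).
have ic : P.-integrable setT (EFin \o cst (1 : R)).
  exact: finite_measure_integrable_cst.
set k := 8 / e ^+ 2 * s ^+ 2.
have k0 : 0 <= k by rewrite mulr_ge0 ?sqr_ge0// divr_ge0// sqr_ge0.
have iZ' : P.-integrable setT (fun w => s%:E * (Z w)%:E)%E by exact: integrableZl.
have iE' : P.-integrable setT (fun w => k%:E * (expR (e * `|Z w|))%:E)%E.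
  exact: integrableZl.
have iD : P.-integrable setT
    (fun w => s%:E * (Z w)%:E + k%:E * (expR (e * `|Z w|))%:E)%E.
  exact: integrableD.
apply: (@le_trans _ _ (\int[P]_w (1%:E + (s%:E * (Z w)%:E
   + k%:E * (expR (e * `|Z w|))%:E)))%E).
  apply: le_integral => //.
  - apply: (le_integrable measurableT _ _
      (integrableD measurableT (integrableD measurableT ic iE) iE)) => //.
      exact: measurable_expRM.
    move=> w _; rewrite /= lee_fin [leLHS]ger0_norm ?expR_ge0//.
    rewrite [leRHS]ger0_norm ?addr_ge0 ?expR_ge0//.
    have h : expR (s * Z w) <= expR (e * `|Z w|).
      rewrite ler_expR; apply: (le_trans (ler_norm _)); rewrite normrM.
      by rewrite ler_wpM2r//; lra.
    by have := expR_ge0 (e * `|Z w|); lra.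
  - exact: integrableD.
  - move=> w _ /=; rewrite lee_fin.
    have := expR_le_quadratic_scaled (Z w) e0 se; rewrite -/k; lra.
rewrite integralD//= integralD//= !integralZl// Zc.
rewrite integral_cst//= probability_setT mule1.
apply: (@le_trans _ _ (1%:E + (s%:E * c%:E + k%:E * K%:E))%E).
  by rewrite leeD2l// leeD2l// lee_wpmul2l// lee_fin.
by rewrite -!EFinM -!EFinD lee_fin /k; lra.
Qed.

Lemma integrable_of_exp_norm (Z : T -> R) (e K : R) : 0 < e ->
  measurable_fun setT Z -> (\int[P]_w (expR (e * `|Z w|))%:E <= K%:E)%E ->
  P.-integrable setT (EFin \o Z).
Proof.
move=> e0 mZ hK.
have maZ : measurable_fun setT (fun w => `|Z w|) by exact: measurableT_comp.
have fin (s : R) : `|s| = e -> (\int[P]_w (expR (s * Z w))%:E < +oo)%E.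
  move=> se; apply: le_lt_trans (ltry K); apply: le_trans hK.
  apply: ge0_le_integral => //.
  - exact: measurable_expRM.
  - exact: (measurable_expRM e maZ).
  - move=> w _; rewrite lee_fin ler_expR; apply: (le_trans (ler_norm _)).
    by rewrite normrM se.
by apply: (integrable_of_exp_moment e0) => //; apply: fin; rewrite ?normrN gtr0_norm.
Qed.

Lemma ge0_lee_prod (I : finType) (f g : I -> \bar R) :
  (forall i, 0 <= f i)%E -> (forall i, f i <= g i)%E ->
  (\prod_i f i <= \prod_i g i)%E.
Proof.
move=> f0 fg.
suff /andP[] : (0 <= \prod_i f i <= \prod_i g i)%E by [].
elim/big_rec2: _ => [|i x y _ /andP[x0 xy]]; first by rewrite lee01 lexx.
by rewrite mule_ge0//= lee_pmul.
Qed.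

(** The last hypothesis is what independence within each row provides. *)
Lemma lln_rows (Z : forall N, 'I_N -> T -> R) (e K c : R) : 0 < e ->
  (forall N i, (2 <= N)%N -> measurable_fun setT (Z N i)) ->
  (forall N i, (2 <= N)%N -> (\int[P]_w (expR (e * `|Z N i w|))%:E <= K%:E)%E) ->
  (forall N i, (2 <= N)%N -> (\int[P]_w (Z N i w)%:E = c%:E)%E) ->
  (forall N s, (2 <= N)%N -> (\int[P]_w (expR (s * \sum_i Z N i w))%:E
     = \prod_i \int[P]_w (expR (s * Z N i w))%:E)%E) ->
  {ae P, forall w, (fun N => N%:R^-1 * \sum_i Z N i w) @ \oo --> c}.
Proof.
move=> e0 mZ hK Zc Zprod.
apply: (@as_cvg_of_exp_moment _ _ _ P (fun N w => \sum_i Z N i w) (e / 2) c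
  (8 / e ^+ 2 * K)).
- by rewrite divr_gt0.
- by move=> N N2; apply: measurable_sum => i; exact: mZ.
- move=> N s N2 se; rewrite Zprod//.
  rewrite -[X in (_ ^+ X)%:E]card_ord -prodr_const -prodEFin.
  apply: ge0_lee_prod => i.
    by apply: integral_ge0 => w _; rewrite lee_fin expR_ge0.
  apply: mgf_le_quadratic => //; [exact: mZ|exact: hK| |exact: Zc].
  by apply: (integrable_of_exp_norm e0) => //; [exact: mZ|exact: hK].
Qed.

End lln_rows.

(** * Gaussian vectors and products of Gaussian variables *)

Section gaussian_vectors.
Context d (T : measurableType d) (R : realType) (P : probability T R).
Variables (n : nat) (Z : T -> 'cV[R]_n) (m : 'cV[R]_n) (G : 'M[R]_n).
Hypothesis gZ : gaussian_vector P Z m G.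

Lemma dotv_delta (a : 'I_n) (v : 'cV[R]_n) : dotv (delta_mx a 0) v = v a 0.
Proof. by rewrite /dotv trmx_delta -rowE mxE. Qed.

Lemma dotvDl (u1 u2 v : 'cV[R]_n) : dotv (u1 + u2) v = dotv u1 v + dotv u2 v.
Proof. by rewrite /dotv linearD mulmxDl mxE. Qed.

Lemma dotvDr (u v1 v2 : 'cV[R]_n) : dotv u (v1 + v2) = dotv u v1 + dotv u v2.
Proof. by rewrite /dotv mulmxDr mxE. Qed.

Lemma measurable_gaussian_coord a : measurable_fun setT (fun w => Z w a 0).
Proof. exact: gaussian_random_vector gZ a. Qed.

Lemma gaussian_var_ge0 a : 0 <= G a a.
Proof.
have := gaussian_cov_psd gZ (delta_mx a 0).
by rewrite dotv_delta -colE mxE.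
Qed.

Lemma gaussian_coord_law a (B : set R) : measurable B ->
  P ((fun w => Z w a 0) @^-1` B) = normal1 (m a 0) (G a a) B.
Proof.
move=> mB; have := gaussian_law gZ (delta_mx a 0) mB.
rewrite !dotv_delta -colE mxE => <-; congr (P _).
by apply/seteqP; split => w /=; rewrite dotv_delta.
Qed.

Lemma gaussian_second_moment u :
  P.-integrable setT (EFin \o (fun w => dotv u (Z w) ^+ 2)) /\
  (\int[P]_w (dotv u (Z w) ^+ 2)%:E
   = (dotv u m ^+ 2 + dotv u (G *m u))%:E)%E.
Proof.
apply: normal1_second_moment.
- rewrite (_ : (fun w => _) = (fun w => \sum_j u j 0 * Z w j 0)).
    apply: measurable_sum => j; apply: measurable_funM => //.
    exact: measurable_gaussian_coord.
  apply/funext => w; rewrite /dotv mxE; apply: eq_bigr => j _; by rewrite mxE.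
- exact: gaussian_cov_psd gZ u.
- move=> B mB; exact: (gaussian_law gZ u mB).
Qed.

(** Polarization: only the laws of linear functionals are known, and the product
    of two coordinates is a combination of three squares of such functionals. *)
Lemma gaussian_cross_moment a b :
  (\int[P]_w (Z w a 0 * Z w b 0)%:E = (m a 0 * m b 0 + G a b)%:E)%E.
Proof.
pose ea : 'cV[R]_n := delta_mx a 0; pose eb : 'cV[R]_n := delta_mx b 0.
have [ia Ea] := gaussian_second_moment ea.
have [ib Eb] := gaussian_second_moment eb.
have [iab Eab] := gaussian_second_moment (ea + eb).
have Gs : G b a = G a b by rewrite -[in LHS](gaussian_cov_sym gZ) mxE.
have E1 w : (Z w a 0 * Z w b 0)%:E = ((2^-1)%:E * ((dotv (ea + eb) (Z w) ^+ 2)%:E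
   - ((dotv ea (Z w) ^+ 2)%:E + (dotv eb (Z w) ^+ 2)%:E)))%E.
  rewrite -[RHS]/((2^-1 * (dotv (ea + eb) (Z w) ^+ 2 -
    (dotv ea (Z w) ^+ 2 + dotv eb (Z w) ^+ 2)))%:E).
  by rewrite dotvDl !dotv_delta; congr EFin; field.
under eq_integral do rewrite E1.
rewrite integralZl//; last by apply: integrableB => //; exact: integrableD.
rewrite integralB//; last exact: integrableD.
rewrite integralD// Ea Eb Eab.
rewrite -[LHS]/((2^-1 * (dotv (ea + eb) m ^+ 2 + dotv (ea + eb) (G *m (ea + eb))
  - (dotv ea m ^+ 2 + dotv ea (G *m ea) + (dotv eb m ^+ 2 + dotv eb (G *m eb)))))%:E).
congr EFin.
rewrite mulmxDr !dotvDl !dotvDr !dotv_delta -!colE !mxE Gs.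
by field.
Qed.

End gaussian_vectors.

Section lln_gaussian.
Context d (T : measurableType d) (R : realType) (P : probability T R).

Variables (A B : forall N, 'I_N -> T -> R) (ma va mb vb : R).
Hypothesis mA : forall N (i : 'I_N), (2 <= N)%N -> measurable_fun setT (@A N i).
Hypothesis mB : forall N (i : 'I_N), (2 <= N)%N -> measurable_fun setT (@B N i).
Hypothesis va0 : 0 <= va.
Hypothesis vb0 : 0 <= vb.
Hypothesis lawA : forall N (i : 'I_N), (2 <= N)%N -> forall C : set R, measurable C ->
  P (@A N i @^-1` C) = normal1 ma va C.
Hypothesis lawB : forall N (i : 'I_N), (2 <= N)%N -> forall C : set R, measurable C ->
  P (@B N i @^-1` C) = normal1 mb vb C.

Let sq_rate_gt0 (v : R) : 0 <= v -> 0 < sq_rate v.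
Proof. by move=> v0; rewrite divr_gt0// invr_gt0 mulr_gt0// ltr_pwDl. Qed.

(** Law of large numbers for products of Gaussian variables. Taking [B] constant
    equal to [1], of law [normal1 1 0], gives the law for [A] alone. *)
Lemma lln_gaussian_prod (c : R) :
  (forall N (i : 'I_N), (2 <= N)%N ->
    (\int[P]_w (@A N i w * @B N i w)%:E = c%:E)%E) ->
  (forall N s, (2 <= N)%N ->
    (\int[P]_w (expR (s * \sum_i (@A N i w * @B N i w)))%:E
     = \prod_i \int[P]_w (expR (s * (@A N i w * @B N i w)))%:E)%E) ->
  {ae P, forall w,
    (fun N => N%:R^-1 * \sum_i (@A N i w * @B N i w)) @ \oo --> c}.
Proof.
move=> ABc prodAB.
have a0 := sq_rate_gt0 va0; have b0 := sq_rate_gt0 vb0.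
(* [`|x * y| <= Num.max (x ^+ 2) (y ^+ 2)], so one of the two exponential
   moments of squares always dominates. *)
pose e := Num.min (sq_rate va) (sq_rate vb).
have e0 : 0 < e by rewrite lt_min a0.
have ea : e <= sq_rate va by rewrite ge_min lexx.
have eb : e <= sq_rate vb by rewrite ge_min lexx orbT.
apply: (@lln_rows _ _ _ P (fun N i w => @A N i w * @B N i w) e
  (sq_bound ma va + sq_bound mb vb)) => //.
  by move=> N i N2; apply: measurable_funM; [exact: mA|exact: mB].
move=> N i N2.
have mAi := mA i N2; have mBi := mB i N2.
have mA2 : measurable_fun setT (fun w => @A N i w ^+ 2) by exact: measurable_funX.
have mB2 : measurable_fun setT (fun w => @B N i w ^+ 2) by exact: measurable_funX.
have mAB : measurable_fun setT (fun w => `|@A N i w * @B N i w|).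
  by apply: measurableT_comp => //; exact: measurable_funM.
have mEA := measurable_expRM (sq_rate va) mA2.
have mEB := measurable_expRM (sq_rate vb) mB2.
apply: (@le_trans _ _ (\int[P]_w ((expR (sq_rate va * (@A N i w) ^+ 2))%:E
    + (expR (sq_rate vb * (@B N i w) ^+ 2))%:E))%E); last first.
  rewrite ge0_integralD// EFinD leeD//.
    by apply: normal1_exp_square => //; exact: lawA.
  by apply: normal1_exp_square => //; exact: lawB.
apply: ge0_le_integral => //.
- exact: (measurable_expRM e mAB).
- exact: emeasurable_funD.
- move=> w _; rewrite -EFinD lee_fin normrM.
  move: (@A N i w) (@B N i w) => x y.
  have [xy|yx] := leP `|x| `|y|.
    apply: (@le_trans _ _ (expR (sq_rate vb * y ^+ 2))); last first.
      by rewrite lerDr expR_ge0.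
    rewrite ler_expR; apply: ler_pM => //; first exact: (ltW e0).
    by rewrite -(real_normK (num_real y)) expr2 ler_wpM2r.
  apply: (@le_trans _ _ (expR (sq_rate va * x ^+ 2))); last first.
    by rewrite lerDl expR_ge0.
  rewrite ler_expR; apply: ler_pM => //; first exact: (ltW e0).
  by rewrite -(real_normK (num_real x)) expr2 ler_wpM2l// (ltW yx).
Qed.

End lln_gaussian.

(** * The noises of an ensemble *)

Section noise.
Variables (R : realType) (dx dy K l : nat).

(** The noises that drive one particle over the first [K] steps: the initial
    state ([None]), the increments of the signal noise ([Some (inl j)]) and those
    of the observation noise ([Some (inr j)]). *)
Definition source := option ('I_K + 'I_K).

Definition noise_dim (s : source) : nat :=
  match s with Some (inr _) => dy | _ => dx end.

Definition noise (N : nat) (z0 : 'I_N -> 'cV[R]_dx) (wb : 'I_N -> R -> 'cV[R]_dx)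
    (vb : 'I_N -> R -> 'cV[R]_dy) (s : source) (i : 'I_N)
    : 'cV[R]_(noise_dim s) :=
  match s with
  | None => z0 i
  | Some (inl j) => incr l (wb i) j
  | Some (inr j) => incr l (vb i) j
  end.

Definition noise_mean (M : lg_params R dx dy) (s : source)
    : 'cV[R]_(noise_dim s) :=
  match s with None => mean0 M | _ => 0 end.

Definition noise_cov (M : lg_params R dx dy) (s : source)
    : 'M[R]_(noise_dim s) :=
  match s with None => cov0 M | _ => (Delta R l)%:M end.

End noise.

Section sub_measurability.
Variables (R : realType) (T : pointedType).

Lemma sub_measurable_vector (n : nat) (Z : T -> 'cV[R]_n) a :
  @measurable_fun _ _ (g_sigma_algebraType (sigma_vector Z)) R setT
    (fun w => Z w a 0).
Proof.
move=> _ B mB; apply: sub_sigma_algebra; apply: sub_sigma_algebra.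
by exists a => //; exists B.
Qed.

Lemma sub_measurable_process (n : nat) (Z : R -> T -> 'cV[R]_n) t a : 0 <= t ->
  @measurable_fun _ _ (g_sigma_algebraType (sigma_process Z)) R setT
    (fun w => Z t w a 0).
Proof.
move=> t0 _ B mB; apply: sub_sigma_algebra; apply: sub_sigma_algebra.
by exists (t, a) => //; exists B.
Qed.

Lemma sub_measurable_incr (n l j : nat) (Z : R -> T -> 'cV[R]_n) a :
  @measurable_fun _ _ (g_sigma_algebraType (sigma_process Z)) R setT
    (fun w => incr l (Z ^~ w) j a 0).
Proof.
rewrite (_ : (fun w => _) = (fun w => Z (j.+1%:R * Delta R l) w a 0
   - Z (j%:R * Delta R l) w a 0)); last by apply/funext => w; rewrite !mxE.
by apply: measurable_funB; apply: sub_measurable_process;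
  rewrite mulr_ge0// invr_ge0 exprn_ge0.
Qed.

End sub_measurability.

Section independence_lemmas.
Context d (T : measurableType d) (R : realType) (P : probability T R).

(** Used to leave out the signal and the observations, whose sigma-algebra is the
    member [None] of the family. *)
Lemma mutual_independence_Some (I : eqType) (F : option I -> set (set T)) :
  mutual_independence P F -> mutual_independence P (F \o Some).
Proof.
move=> h J E uJ EF.
have := h (map Some J) (fun o => if o is Some i then E i else setT).
rewrite map_inj_uniq; last by move=> ? ? [].
move=> /(_ uJ); rewrite big_map => <-.
  congr (P _); apply/seteqP; split => w Ew i /=.
    by move=> /mapP[j jJ ->]; exact: Ew.
  by move=> iJ; apply: (Ew (Some i)); exact: map_f.
by move=> _ /mapP[j jJ ->]; exact: EF.
Qed.

Lemma mutual_independence2 (I : eqType) (F : I -> set (set T)) i j :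
  mutual_independence P F -> i != j -> forall A B, F i A -> F j B ->
  P (A `&` B) = (P A * P B)%E.
Proof.
move=> h ij A B FA FB.
have := h [:: i; j] (fun k => if k == i then A else B).
rewrite /= inE ij => /(_ isT).
rewrite !big_cons big_nil mule1 eqxx eq_sym (negbTE ij) => <-.
  congr (P _); apply/seteqP; split => w.
    by case=> Aw Bw k /=; rewrite !inE; case: eqP.
  move=> Ew; split.
    by have := Ew i; rewrite /= inE eqxx => /(_ isT).
  by have := Ew j; rewrite /= !inE eqxx orbT eq_sym (negbTE ij) => /(_ isT).
move=> k; rewrite !inE => /orP[/eqP ->|/eqP ->]; first by rewrite eqxx.
by rewrite eq_sym (negbTE ij).
Qed.

End independence_lemmas.

Section ensemble.
Context (R : realType) d (T : measurableType d) (P : probability T R).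
Variables (dx dy : nat) (M : lg_params R dx dy).
Variables (X : R -> T -> 'cV[R]_dx) (Y : R -> T -> 'cV[R]_dy).
Variables (N l K : nat).
Variables (xi0 : 'I_N -> T -> 'cV[R]_dx)
  (Wb : 'I_N -> R -> T -> 'cV[R]_dx) (Vb : 'I_N -> R -> T -> 'cV[R]_dy).
Hypothesis Hens : ensemble_noise P M X Y xi0 Wb Vb.

Let F : 'I_N + 'I_N + 'I_N -> set (set T) :=
  ensemble_sigma X Y xi0 Wb Vb \o Some.

Local Notation noise_rv s i := (fun w => noise l (fun i => xi0 i w)
  (fun i t => Wb i t w) (fun i t => Vb i t w) s i).
Local Notation src := (source K).

Let FI k : setI_closed (F k).
Proof. by case: k => [[i|i]|i]; exact: setI_closed_sigma. Qed.

Let FT k : F k setT.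
Proof.
case: k => [[i|i]|i]; rewrite /F/= -setC0;
 by apply: sigma_algebraC; exact: sigma_algebra0.
Qed.

Let Fid k : <<s F k >> `<=` F k.
Proof.
suff -> : <<s F k >> = F k by [].
by apply: sigma_algebra_id; case: k => [[i|i]|i]; exact: smallest_sigma_algebra.
Qed.

Let sigma_process_measurable n (Z : R -> T -> 'cV[R]_n) :
  (forall t, 0 <= t -> random_vector (Z t)) -> sigma_process Z `<=` measurable.
Proof.
move=> mZ; apply: sub_gen_measurable => A [[t a] /= t0 [B mB <-]].
exact: mZ.
Qed.

Let Fm k : F k `<=` measurable.
Proof.
case: k => [[i|i]|i].
- apply: sub_gen_measurable => A [a _ [B mB <-]].
  by apply: (gaussian_random_vector (ens_init Hens i)).
- apply: sigma_process_measurable; exact: bm_random_vector (ens_sig_bm Hens i).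
- apply: sigma_process_measurable; exact: bm_random_vector (ens_obs_bm Hens i).
Qed.

Let Find : mutual_independence P F.
Proof. exact: mutual_independence_Some (ens_indep Hens). Qed.

(** The index of the independent sigma-algebra from which a noise is taken. *)
Definition noise_origin (i : 'I_N) (s : src) : 'I_N + 'I_N + 'I_N :=
  match s with
  | None => inl (inl i) | Some (inl _) => inl (inr i) | Some (inr _) => inr i
  end.

Let particle (i : 'I_N) : seq ('I_N + 'I_N + 'I_N) :=
  [:: inl (inl i); inl (inr i); inr i].

Let noise_origin_in i s : noise_origin i s \in particle i.
Proof. by case: s => [[j|j]|]; rewrite !inE eqxx ?orbT. Qed.

Lemma sub_measurable_noise (s : src) i a :
  sub_measurable (F (noise_origin i s)) (fun w => noise_rv s i w a 0).
Proof.
case: s a => [[j|j]|] a /=.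
- exact: (@sub_measurable_incr _ _ _ _ _ (Wb i)).
- exact: (@sub_measurable_incr _ _ _ _ _ (Vb i)).
- exact: sub_measurable_vector.
Qed.

Lemma noise_gaussian (s : src) i :
  gaussian_vector P (noise_rv s i) (noise_mean M s) (noise_cov l M s).
Proof.
have D0 : 0 <= Delta R l by rewrite invr_ge0 exprn_ge0.
have incr_gauss n (Z : R -> T -> 'cV[R]_n) (j : nat) : brownian_motion P Z ->
    gaussian_vector P (fun w => incr l (Z ^~ w) j) 0 (Delta R l)%:M.
  move=> bmZ.
  have -> : Delta R l = j.+1%:R * Delta R l - j%:R * Delta R l.
    by rewrite -mulrBl -natrB// subSnn mul1r.
  apply: (bm_increment bmZ); first by rewrite mulr_ge0.
  by rewrite ler_wpM2r// ler_nat.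
case: s => [[j|j]|] /=.
- exact: incr_gauss (ens_sig_bm Hens i).
- exact: incr_gauss (ens_obs_bm Hens i).
- exact: ens_init Hens i.
Qed.

(** Two different noises of the same particle either come from different
    independent sigma-algebras, or are increments of the same Brownian motion
    over disjoint time intervals. *)
Lemma noise_indep (s s' : src) i a b : s != s' ->
  indep_rv P (fun w => noise_rv s i w a 0) (fun w => noise_rv s' i w b 0).
Proof.
move=> ss'.
(* Different origins are independent by hypothesis; the same origin leaves two
   increments of one Brownian motion. *)
have [oo|oo] := eqVneq (noise_origin i s) (noise_origin i s'); last first.
  move=> A B mA mB; apply: (mutual_independence2 Find oo); apply: Fid.
    exact: sub_measurableP (@sub_measurable_noise s i a) mA.
  exact: sub_measurableP (@sub_measurable_noise s' i b) mB.
have bmi n (Z : R -> T -> 'cV[R]_n) (j j' : 'I_K) a' b' : brownian_motion P Z ->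
    j != j' -> indep_rv P (fun w => incr l (Z ^~ w) j a' 0)
      (fun w => incr l (Z ^~ w) j' b' 0).
  move=> bmZ jj' A B mA mB.
  have h0 : 0 <= 0%:R * Delta R l by rewrite mul0r.
  have hm : {homo (fun k : nat => k%:R * Delta R l) : i j / (i <= j)%N >-> i <= j}.
    by move=> p q pq; rewrite ler_wpM2r ?ler_nat// invr_ge0 exprn_ge0.
  have ind := @bm_independent_increments _ _ _ _ _ _ bmZ K _ h0 hm.
  by apply: (mutual_independence2 ind jj');
    apply: sub_sigma_algebra; [exists a'|exists b'] => //; [exists A|exists B];
    rewrite ?setTI.
case: s s' ss' oo a b => [[j|j]|] [[j'|j']|] //= ss' _ a b.
- by apply: bmi (ens_sig_bm Hens i) _; apply: contra_neq ss' => ->.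
- by apply: bmi (ens_obs_bm Hens i) _; apply: contra_neq ss' => ->.
Qed.

Lemma noise_cross_moment (s s' : src) i a b : s != s' ->
  (\int[P]_w (noise_rv s i w a 0 * noise_rv s' i w b 0)%:E
   = (noise_mean M s a 0 * noise_mean M s' b 0)%:E)%E.
Proof.
move=> ss'; have gs := noise_gaussian s i; have gs' := noise_gaussian s' i.
have [i1 e1] := normal1_mean (measurable_gaussian_coord gs a)
  (gaussian_var_ge0 gs a) (@gaussian_coord_law _ _ _ _ _ _ _ _ gs a).
have [i2 e2] := normal1_mean (measurable_gaussian_coord gs' b)
  (gaussian_var_ge0 gs' b) (@gaussian_coord_law _ _ _ _ _ _ _ _ gs' b).
rewrite expectationM_indep//.
- by rewrite e1 e2.
- exact: measurable_gaussian_coord gs a.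
- exact: measurable_gaussian_coord gs' b.
- exact: noise_indep.
Qed.

(** Different particles use disjoint groups of the independent sigma-algebras. *)
Lemma noise_exp_sum (f : 'I_N -> T -> R) (t : R) :
  (forall i, sub_measurable (\bigcup_(k in [set` particle i]) F k) (f i)) ->
  (\int[P]_w (expR (t * \sum_i f i w))%:E
   = \prod_i \int[P]_w (expR (t * f i w))%:E)%E.
Proof.
move=> mf.
have uniq_particles (q : seq 'I_N) : uniq q -> uniq (flatten (map particle q)).
  have own (i : 'I_N) k : k \in particle i ->
      (match k with inl (inl i) | inl (inr i) | inr i => i end) = i.
    by rewrite !inE => /or3P[] /eqP ->.
  elim: q => [//|i q IH] /andP[iq uq].
  change (uniq (particle i ++ flatten (map particle q))).
  rewrite cat_uniq IH// andbT.
  apply/andP; split; first by [].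
  apply/hasPn => k /flattenP[_ /mapP[j jq ->] kj]; apply/negP => ki.
  by move: iq; rewrite -(own _ _ ki) (own _ _ kj) jq.
rewrite -(ge0_expectation_prod_groups FI FT Fm Find (g := particle)
  (f := fun i w => expR (t * f i w))).
- by apply: eq_integral => w _; rewrite mulr_sumr expR_sum.
- exact/uniq_particles/index_enum_uniq.
- move=> i; apply: (@measurableT_comp _ _ _ _ _ _ (@expR R)) => //.
  by apply: measurable_funM => //; exact: mf.
- by move=> i w; exact: expR_ge0.
Qed.

Lemma sub_measurable_noise_particle (s : src) i a :
  sub_measurable (\bigcup_(k in [set` particle i]) F k)
    (fun w => noise_rv s i w a 0).
Proof.
apply: sub_measurable_sub (@sub_measurable_noise s i a).
apply: sub_sigma_algebra2 => A FA; exists (noise_origin i s) => //=.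
Qed.

Lemma noise_exp_sum_prod (s s' : src) a b t :
  (\int[P]_w (expR (t * \sum_i (noise_rv s i w a 0 * noise_rv s' i w b 0)))%:E
   = \prod_i \int[P]_w (expR (t * (noise_rv s i w a 0 * noise_rv s' i w b 0)))%:E)%E.
Proof.
apply: noise_exp_sum => i; apply: measurable_funM;
  exact: sub_measurable_noise_particle.
Qed.

Lemma noise_exp_sum1 (s : src) a t :
  (\int[P]_w (expR (t * \sum_i (noise_rv s i w a 0)))%:E
   = \prod_i \int[P]_w (expR (t * (noise_rv s i w a 0)))%:E)%E.
Proof. by apply: noise_exp_sum => i; exact: sub_measurable_noise_particle. Qed.

End ensemble.

(** * The strong law for the noises *)

Section ensemble_lln.
Context (R : realType) d (T : measurableType d) (P : probability T R).
Variables (dx dy : nat) (M : lg_params R dx dy).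
Variables (X : R -> T -> 'cV[R]_dx) (Y : R -> T -> 'cV[R]_dy).
Variables (l K : nat).
Variables (xi0 : forall N : nat, 'I_N -> T -> 'cV[R]_dx)
  (Wb : forall N : nat, 'I_N -> R -> T -> 'cV[R]_dx)
  (Vb : forall N : nat, 'I_N -> R -> T -> 'cV[R]_dy).
Hypothesis Hens : forall N : nat, (2 <= N)%N ->
  ensemble_noise P M X Y (@xi0 N) (@Wb N) (@Vb N).

Local Notation nz N s w := (noise l (fun i => @xi0 N i w)
  (fun i t => @Wb N i t w) (fun i t => @Vb N i t w) s).
Local Notation src := (source K).

Lemma noise_lln_pair (s s' : src) a b c :
  (forall N (i : 'I_N), (2 <= N)%N ->
    (\int[P]_w (nz N s w i a 0 * nz N s' w i b 0)%:E = c%:E)%E) ->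
  {ae P, forall w, (fun N => N%:R^-1 *
     \sum_i (nz N s w i a 0 * nz N s' w i b 0)) @ \oo --> c}.
Proof.
move=> hc.
have G N (N2 : (2 <= N)%N) (u : src) i := noise_gaussian l (Hens N2) u i.
apply: (@lln_gaussian_prod _ _ _ P (fun N i w => nz N s w i a 0)
  (fun N i w => nz N s' w i b 0) (noise_mean M s a 0) (noise_cov l M s a a)
  (noise_mean M s' b 0) (noise_cov l M s' b b)).
- by move=> N i N2; exact: measurable_gaussian_coord (G N N2 s i) a.
- by move=> N i N2; exact: measurable_gaussian_coord (G N N2 s' i) b.
- exact: gaussian_var_ge0 (G 2%N isT s ord0) a.
- exact: gaussian_var_ge0 (G 2%N isT s' ord0) b.
- by move=> N i N2 C mC; exact: gaussian_coord_law (G N N2 s i) a _ mC.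
- by move=> N i N2 C mC; exact: gaussian_coord_law (G N N2 s' i) b _ mC.
- exact: hc.
- by move=> N t N2; exact: (noise_exp_sum_prod l (Hens N2)).
Qed.

Lemma noise_lln_mean (s : src) a :
  {ae P, forall w, (fun N => N%:R^-1 * \sum_i nz N s w i a 0) @ \oo
     --> noise_mean M s a 0}.
Proof.
have G N (N2 : (2 <= N)%N) (u : src) i := noise_gaussian l (Hens N2) u i.
have H := @lln_gaussian_prod _ _ _ P (fun N i w => nz N s w i a 0)
  (fun N i w => 1) (noise_mean M s a 0) (noise_cov l M s a a) 1 0.
have {}H : {ae P, forall w, (fun N => N%:R^-1 *
     \sum_i (nz N s w i a 0 * 1)) @ \oo --> noise_mean M s a 0}.
  apply: H => //.
  - by move=> N i N2; exact: measurable_gaussian_coord (G N N2 s i) a.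
  - exact: gaussian_var_ge0 (G 2%N isT s ord0) a.
  - by move=> N i N2 C mC; exact: gaussian_coord_law (G N N2 s i) a _ mC.
  - move=> N i N2 C mC; rewrite /normal1 eqxx diracE.
    rewrite preimage_cst; case: ifPn => C1.
      by rewrite probability_setT.
    by rewrite measure0.
  - move=> N i N2; under eq_integral do rewrite mulr1.
    by apply: (normal1_mean (measurable_gaussian_coord (G N N2 s i) a) _
      (@gaussian_coord_law _ _ _ _ _ _ _ _ (G N N2 s i) a)).2;
      exact: gaussian_var_ge0 (G N N2 s i) a.
  - move=> N t N2.
    under eq_integral do under eq_bigr do rewrite mulr1.
    under [RHS]eq_bigr do under eq_integral do rewrite mulr1.
    exact: (noise_exp_sum1 l (Hens N2)).
apply: filterS H => w.
rewrite (_ : (fun N => N%:R^-1 * \sum_i (nz N s w i a 0 * 1))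
  = (fun N => N%:R^-1 * \sum_i nz N s w i a 0))//.
by apply/funext => N; under eq_bigr do rewrite mulr1.
Qed.

(** Finitely many almost sure statements, gathered on one event. *)
Lemma noise_lln : {ae P, forall w,
  [/\ forall (s : src) a, (fun N => N%:R^-1 * \sum_i nz N s w i a 0) @ \oo
         --> noise_mean M s a 0,
      forall (s : src) a b, (fun N => N%:R^-1 *
         \sum_i (nz N s w i a 0 * nz N s w i b 0)) @ \oo
         --> noise_mean M s a 0 * noise_mean M s b 0 + noise_cov l M s a b &
      forall (s s' : src) a b, s != s' -> (fun N => N%:R^-1 *
         \sum_i (nz N s w i a 0 * nz N s' w i b 0)) @ \oo
         --> noise_mean M s a 0 * noise_mean M s' b 0]}.
Proof.
have G N (N2 : (2 <= N)%N) (u : src) i := noise_gaussian l (Hens N2) u i.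
have H1 : {ae P, forall w, forall (s : src) a, (fun N => N%:R^-1 * \sum_i nz N s w i a 0) @ \oo
         --> noise_mean M s a 0}.
  by apply: filter_forall => s; apply: filter_forall => a; exact: noise_lln_mean.
have H2 : {ae P, forall w, forall (s : src) a b, (fun N => N%:R^-1 *
         \sum_i (nz N s w i a 0 * nz N s w i b 0)) @ \oo
         --> noise_mean M s a 0 * noise_mean M s b 0 + noise_cov l M s a b}.
  apply: filter_forall => s; apply: filter_forall => a; apply: filter_forall => b.
  by apply: noise_lln_pair => N i N2; exact: gaussian_cross_moment (G N N2 s i) a b.
have H3 : {ae P, forall w, forall (s s' : src) a b, s != s' -> (fun N => N%:R^-1 *
         \sum_i (nz N s w i a 0 * nz N s' w i b 0)) @ \oo
         --> noise_mean M s a 0 * noise_mean M s' b 0}.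
  apply: filter_forall => s; apply: filter_forall => s'.
  apply: filter_forall => a; apply: filter_forall => b.
  have [e|/eqP ss'] := pselect (s = s').
    by subst s'; apply: aeW => w; rewrite eqxx.
  have := @noise_lln_pair s s' a b (noise_mean M s a 0 * noise_mean M s' b 0).
  move=> H; apply: filterS (H _) => [w hw _ //|N i N2].
  by apply: (noise_cross_moment l (Hens N2)).
by apply: filterS3 H1 H2 H3 => w h1 h2 h3; split.
Qed.

End ensemble_lln.

(** * Limits of matrices and of sample statistics *)

Section matrix_limits.
Variable R : realType.

(** Entrywise convergence, so that limits of matrix expressions reduce to limits of
    real sequences in every dimension. *)
Definition mcvg m n (u : nat -> 'M[R]_(m, n)) (L : 'M[R]_(m, n)) :=
  forall i j, (fun N => u N i j) @ \oo --> L i j.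

Lemma mcvg_cst m n (A : 'M[R]_(m, n)) : mcvg (fun=> A) A.
Proof. by move=> i j; exact: cvg_cst. Qed.

Lemma mcvgD m n (u v : nat -> 'M[R]_(m, n)) A B :
  mcvg u A -> mcvg v B -> mcvg (fun N => u N + v N) (A + B).
Proof.
move=> uA vB i j; rewrite mxE.
rewrite (_ : (fun N => _) = (fun N => u N i j + v N i j)); first exact: cvgD.
by apply/funext => N; rewrite mxE.
Qed.

Lemma mcvgZ m n (c : R) (u : nat -> 'M[R]_(m, n)) A :
  mcvg u A -> mcvg (fun N => c *: u N) (c *: A).
Proof.
move=> uA i j; rewrite mxE.
rewrite (_ : (fun N => _) = (fun N => c * u N i j)); first by apply: cvgM; [exact: cvg_cst|exact: uA].
by apply/funext => N; rewrite mxE.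
Qed.

Lemma mcvgN m n (u : nat -> 'M[R]_(m, n)) A :
  mcvg u A -> mcvg (fun N => - u N) (- A).
Proof.
move=> uA i j; rewrite mxE.
rewrite (_ : (fun N => _) = (fun N => - u N i j)); first exact: cvgN.
by apply/funext => N; rewrite mxE.
Qed.

Lemma mcvgB m n (u v : nat -> 'M[R]_(m, n)) A B :
  mcvg u A -> mcvg v B -> mcvg (fun N => u N - v N) (A - B).
Proof. by move=> uA vB; apply: mcvgD => //; exact: mcvgN. Qed.

Lemma mcvgM m n p (u : nat -> 'M[R]_(m, n)) (v : nat -> 'M[R]_(n, p)) A B :
  mcvg u A -> mcvg v B -> mcvg (fun N => u N *m v N) (A *m B).
Proof.
move=> uA vB i j; rewrite mxE.
rewrite (_ : (fun N => _) = (fun N => \sum_k u N i k * v N k j)).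
  by apply: cvg_big => [|k _]; [exact: add_continuous|exact: cvgM].
by apply/funext => N; rewrite mxE.
Qed.

Lemma mcvgT m n (u : nat -> 'M[R]_(m, n)) A :
  mcvg u A -> mcvg (fun N => (u N)^T) A^T.
Proof.
move=> uA i j; rewrite mxE.
rewrite (_ : (fun N => _) = (fun N => u N j i)); first exact: uA.
by apply/funext => N; rewrite mxE.
Qed.

Lemma mcvg_unique m n (u : nat -> 'M[R]_(m, n)) A B :
  mcvg u A -> mcvg u B -> A = B.
Proof.
move=> uA uB; apply/matrixP => i j.
by rewrite -(cvg_lim _ (uA i j))// -(cvg_lim _ (uB i j)).
Qed.

Lemma eq_mcvg m n (u v : nat -> 'M[R]_(m, n)) A :
  (forall N, u N = v N) -> mcvg u A -> mcvg v A.
Proof. by move=> uv; rewrite (_ : v = u)//; apply/funext => N; rewrite uv. Qed.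

Lemma cvg_dotv n (u v : nat -> 'cV[R]_n) a b : mcvg u a -> mcvg v b ->
  (fun N => dotv (u N) (v N)) @ \oo --> dotv a b.
Proof. by move=> ua vb; apply: (mcvgM (mcvgT ua) vb). Qed.

End matrix_limits.

Section sample_statistics.
Variable R : realType.

Definition center_sample n N (z : 'I_N -> 'cV[R]_n) (i : 'I_N) :=
  z i - sample_mean z.

Definition cross_cov n p N (u : 'I_N -> 'cV[R]_n) (v : 'I_N -> 'cV[R]_p)
    : 'M[R]_(n, p) :=
  (N%:R - 1)^-1 *: \sum_i center_sample u i *m (center_sample v i)^T.

Lemma cross_covT n p N (u : 'I_N -> 'cV[R]_n) (v : 'I_N -> 'cV[R]_p) :
  (cross_cov u v)^T = cross_cov v u.
Proof.
rewrite /cross_cov linearZ/= raddf_sum/=; congr (_ *: _).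
by apply: eq_bigr => i _; rewrite trmx_mul trmxK.
Qed.

Lemma sample_mean_affine n p q r N (F : 'M[R]_(n, p)) (G : 'M[R]_(n, q))
    (H : 'M[R]_(n, r)) (c : 'cV[R]_n) (u : 'I_N -> 'cV[R]_p)
    (v : 'I_N -> 'cV[R]_q) (x : 'I_N -> 'cV[R]_r) : (0 < N)%N ->
  sample_mean (fun i => F *m u i + G *m v i - H *m x i + c)
  = F *m sample_mean u + G *m sample_mean v - H *m sample_mean x + c.
Proof.
move=> N0; rewrite /sample_mean !big_split/= sumrN -!mulmx_sumr -!scalemxAr.
rewrite !scalerDr scalerN sumr_const card_ord -[c *+ N]scaler_nat scalerA mulVf ?scale1r//.
by rewrite pnatr_eq0 -lt0n.
Qed.

(** Centering removes the common term [c]. An index [i : 'I_N] witnesses that the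
    sample is not empty, as the mean of a constant sample requires. *)
Lemma center_sample_affine n p q r N (F : 'M[R]_(n, p)) (G : 'M[R]_(n, q))
    (H : 'M[R]_(n, r)) (c : 'cV[R]_n) (u : 'I_N -> 'cV[R]_p)
    (v : 'I_N -> 'cV[R]_q) (x : 'I_N -> 'cV[R]_r) i :
  center_sample (fun i => F *m u i + G *m v i - H *m x i + c) i
  = F *m center_sample u i + G *m center_sample v i - H *m center_sample x i.
Proof.
have N0 : (0 < N)%N by apply: leq_trans (ltn_ord i).
rewrite /center_sample sample_mean_affine// !mulmxBr !opprD !opprK.
by apply/matrixP => a b; rewrite !mxE; ring.
Qed.

Lemma cross_cov_affine n p q r m N (F : 'M[R]_(n, p)) (G : 'M[R]_(n, q))
    (H : 'M[R]_(n, r)) (c : 'cV[R]_n) (u : 'I_N -> 'cV[R]_p)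
    (v : 'I_N -> 'cV[R]_q) (x : 'I_N -> 'cV[R]_r) (y : 'I_N -> 'cV[R]_m) :
  cross_cov (fun i => F *m u i + G *m v i - H *m x i + c) y
  = F *m cross_cov u y + G *m cross_cov v y - H *m cross_cov x y.
Proof.
rewrite /cross_cov -!scalemxAr -scalerDr -scalerBr; congr (_ *: _).
rewrite !mulmx_sumr -big_split -sumrB; apply: eq_bigr => i _.
by rewrite center_sample_affine mulmxBl mulmxDl !mulmxA.
Qed.

Lemma cross_cov_entry n p N (u : 'I_N -> 'cV[R]_n) (v : 'I_N -> 'cV[R]_p) a b :
  (0 < N)%N ->
  cross_cov u v a b = N%:R / (N%:R - 1) *
    (N%:R^-1 * (\sum_i u i a 0 * v i b 0)
     - (N%:R^-1 * \sum_i u i a 0) * (N%:R^-1 * \sum_i v i b 0)).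
Proof.
move=> N0; rewrite /cross_cov mxE summxE.
have Nn : N%:R != 0 :> R by rewrite pnatr_eq0 -lt0n.
set su := \sum_i u i a 0; set sv := \sum_i v i b 0.
have E i : (center_sample u i *m (center_sample v i)^T) a b
   = u i a 0 * v i b 0 - N%:R^-1 * sv * u i a 0 - N%:R^-1 * su * v i b 0
     + N%:R^-1 * su * (N%:R^-1 * sv).
  by rewrite mxE big_ord1 !mxE !summxE -/su -/sv; ring.
under eq_bigr do rewrite E.
rewrite !big_split/= !sumrN -!mulr_sumr -/su -/sv sumr_const card_ord -mulr_natr.
set D := (_ - 1)^-1.
by field.
Qed.

(** The bias correction [N / (N - 1)] tends to [1], and the centered second
    moment is the raw one minus the product of the means. *)
Lemma cross_cov_cvg n p (u : forall N, 'I_N -> 'cV[R]_n)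
    (v : forall N, 'I_N -> 'cV[R]_p) (mu : 'cV[R]_n) (nu : 'cV[R]_p)
    (G : 'M[R]_(n, p)) :
  (forall a, (fun N => N%:R^-1 * \sum_i @u N i a 0) @ \oo --> mu a 0) ->
  (forall b, (fun N => N%:R^-1 * \sum_i @v N i b 0) @ \oo --> nu b 0) ->
  (forall a b, (fun N => N%:R^-1 * \sum_i (@u N i a 0 * @v N i b 0)) @ \oo
     --> mu a 0 * nu b 0 + G a b) ->
  mcvg (fun N => cross_cov (@u N) (@v N)) G.
Proof.
move=> hu hv huv a b.
have h1 : (fun N => N%:R / (N%:R - 1) : R) @ \oo --> (1 : R).
  rewrite -(cvg_shiftS (fun N => N%:R / (N%:R - 1) : R)).
  have h : (fun N => (1 - N.+1%:R^-1)^-1 : R) @ \oo --> ((1 - 0)^-1 : R).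
    apply: cvgV; first by rewrite subr0 oner_neq0.
    by apply: cvgB; [exact: cvg_cst|exact: cvg_harmonic].
  rewrite subr0 invr1 in h; apply: cvg_trans h; apply: near_eq_cvg; near=> N.
  have N0 : (0 < N)%N by near: N; exact: nbhs_infty_gt.
  have N1 : N.+1%:R - 1 != 0 :> R by rewrite -natr1 addrK pnatr_eq0 -lt0n.
  have N2 : N.+1%:R != 0 :> R by rewrite pnatr_eq0.
  rewrite /=; move: N.+1%:R N1 N2 => x N1 N2.
  by field; rewrite N1 N2.
have h2 : (fun N => N%:R / (N%:R - 1) * (N%:R^-1 * (\sum_i @u N i a 0 * @v N i b 0)
     - (N%:R^-1 * \sum_i @u N i a 0) * (N%:R^-1 * \sum_i @v N i b 0))) @ \oo
     --> 1 * (mu a 0 * nu b 0 + G a b - mu a 0 * nu b 0).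
  by apply: cvgM => //; apply: cvgB => //; apply: cvgM.
rewrite mul1r addrAC subrr add0r in h2.
apply: cvg_trans h2; apply: near_eq_cvg; near=> N.
rewrite cross_cov_entry//; near: N; exact: nbhs_infty_gt.
Unshelve. all: by end_near.
Qed.

Lemma sample_mean_cvg n (u : forall N, 'I_N -> 'cV[R]_n) (mu : 'cV[R]_n) :
  (forall a, (fun N => N%:R^-1 * \sum_i @u N i a 0) @ \oo --> mu a 0) ->
  mcvg (fun N => sample_mean (@u N)) mu.
Proof.
move=> h a j; rewrite (ord1 j).
rewrite (_ : (fun N => _) = (fun N => N%:R^-1 * \sum_i @u N i a 0))//.
by apply/funext => N; rewrite mxE summxE.
Qed.

End sample_statistics.

(** * The limit of the ensemble recursion *)

Section enkbf_limit.
Variables (R : realType) (dx dy : nat) (M : lg_params R dx dy).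
Variables (l K : nat) (y : R -> 'cV[R]_dy).
Variables (z0 : forall N : nat, 'I_N -> 'cV[R]_dx)
  (wb : forall N : nat, 'I_N -> R -> 'cV[R]_dx)
  (vb : forall N : nat, 'I_N -> R -> 'cV[R]_dy).
Hypothesis obs_sd_sym : (obs_sd M)^T = obs_sd M.
Hypothesis obs_sd_unit : obs_sd M \in unitmx.
Hypothesis sig_sd_sym : (sig_sd M)^T = sig_sd M.

Local Notation src := (source K).
Local Notation nz N s := (noise l (@z0 N) (@wb N) (@vb N) s).
Local Notation Dt := (Delta R l).

Hypothesis noise_mean_cvg : forall s : src,
  mcvg (fun N => sample_mean (nz N s)) (noise_mean M s).
Hypothesis noise_cov_cvg : forall s : src,
  mcvg (fun N => cross_cov (nz N s) (nz N s)) (noise_cov l M s).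
Hypothesis noise_cross_cov_cvg : forall s s' : src, s != s' ->
  mcvg (fun N => cross_cov (nz N s) (nz N s')) 0.

Local Notation xi N k := (enkbf M l y (@z0 N) (@wb N) (@vb N) k).
Local Notation m k := (kb_mean M l y k).
Local Notation G k := (kb_cov M l k).

Let Rinv_sym : (obs_cov_inv M)^T = obs_cov_inv M.
Proof. by rewrite /obs_cov_inv trmx_inv trmx_mul obs_sd_sym. Qed.

Let S_sym : (Smx M)^T = Smx M.
Proof. by rewrite /Smx !trmx_mul trmxK Rinv_sym mulmxA. Qed.

Let gain (A : 'M[R]_dx) := A *m (obs M)^T *m obs_cov_inv M.

Let trans (A : 'M[R]_dx) := 1%:M + Dt *: (drift M - A *m Smx M).

(** The update of one particle is affine in its state and in its two increments,
    with coefficients that are common to the whole ensemble. *)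
Lemma enkbf_step N k i :
  xi N k.+1 i = trans (sample_cov (xi N k)) *m xi N k i
    + sig_sd M *m incr l (@wb N i) k
    - (gain (sample_cov (xi N k)) *m obs_sd M) *m incr l (@vb N i) k
    + gain (sample_cov (xi N k)) *m incr l y k.
Proof.
rewrite /= -/(enkbf M l y (@z0 N) (@wb N) (@vb N) k) -/(gain _).
set A := sample_cov _; set z := enkbf _ _ _ _ _ _ _ _.
set dw := incr l (@wb N i) k; set dv := incr l (@vb N i) k; set dy' := incr l y k.
rewrite /trans mulmxDl mul1mx -scalemxAl mulmxBl.
have -> : A *m Smx M = gain A *m obs M by rewrite /gain /Smx !mulmxA.
rewrite (mulmxBr (gain A) dy') (mulmxDr (gain A) (_ *: _)).
rewrite -[gain A *m (_ *: _)]scalemxAr !mulmxA scalerBr.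
by apply/matrixP => a b; rewrite !mxE; ring.
Qed.

(** Written as the limit of the sample mean of [enkbf_step]: the two zeros are the
    means of the increments. *)
Lemma kb_mean_step k :
  m k.+1 = trans (G k) *m m k + sig_sd M *m 0
    - (gain (G k) *m obs_sd M) *m 0 + gain (G k) *m incr l y k.
Proof.
rewrite /= -/(gain _) /trans !mulmx0 subr0 addr0.
set dy' := incr l y k; set x := kb_mean M l y k; set A := kb_cov M l k.
rewrite mulmxDl mul1mx -scalemxAl mulmxBl.
have -> : A *m Smx M = gain A *m obs M by rewrite /gain /Smx !mulmxA.
rewrite (mulmxBr (gain A) dy').
rewrite -[gain A *m (_ *: _)]scalemxAr !mulmxA scalerBr.
by apply/matrixP => a b; rewrite !mxE; ring.
Qed.

Let gain_noise (A : 'M[R]_dx) : A^T = A ->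
  (gain A *m obs_sd M) *m (gain A *m obs_sd M)^T = A *m Smx M *m A.
Proof.
move=> As.
have e p (B : 'M[R]_(_, p)) : obs_cov_inv M *m (obs_sd M *m (obs_sd M *m
    (obs_cov_inv M *m B))) = obs_cov_inv M *m B.
  congr (_ *m _); rewrite /obs_cov_inv !mulmxA mulmxV ?mul1mx//.
  by rewrite unitmx_mul obs_sd_unit.
by rewrite /gain !trmx_mul trmxK Rinv_sym As obs_sd_sym /Smx -!mulmxA e.
Qed.

(** The three summands are the limits of the contributions of the current state,
    of the signal noise and of the perturbed observations. The gain applied to
    the observation noise contributes [G S G], which turns the [- 2 G S G] of the
    first summand into the [- G S G] of the Riccati map. *)
Lemma kb_cov_step k : (G k)^T = G k ->
  G k.+1 = trans (G k) *m G k *m (trans (G k))^T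
    + sig_sd M *m (sig_sd M *m Dt%:M)^T
    + (gain (G k) *m obs_sd M) *m (gain (G k) *m obs_sd M *m Dt%:M)^T.
Proof.
move=> Gs; rewrite [LHS]/= -/(G k); set A := G k in Gs *.
rewrite ![(_ *m Dt%:M)^T]trmx_mul !tr_scalar_mx !mul_scalar_mx -!scalemxAr.
rewrite gain_noise// sig_sd_sym -/(sig_cov M) /Ricc.
set B := drift M - A *m Smx M.
have Bt : B^T = (drift M)^T - Smx M *m A.
  by rewrite /B linearB/= trmx_mul S_sym Gs.
have tt : (trans A)^T = 1%:M + Dt *: B^T.
  by rewrite /trans linearD/= trmx1 linearZ.
rewrite tt /trans -/B -Bt mulmxDl mul1mx mulmxDr mulmx1 -!scalemxAl.
rewrite mulmxDl -!scalemxAr -!scalemxAl scalerA -expr2.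
have -> : drift M *m A + A *m (drift M)^T - A *m Smx M *m A + sig_cov M
   = B *m A + A *m B^T + A *m Smx M *m A + sig_cov M.
  rewrite Bt /B mulmxBl mulmxBr !mulmxA.
  by apply/matrixP => a b; rewrite !mxE; ring.
by rewrite !scalerDr; apply/matrixP => a b; rewrite !mxE; ring.
Qed.

(** The third property is what makes the induction work: the ensemble at step [k]
    is asymptotically uncorrelated with every increment that is still to come. *)
Lemma enkbf_cvg k : (k <= K)%N ->
  [/\ mcvg (fun N => sample_mean (xi N k)) (m k),
      mcvg (fun N => sample_cov (xi N k)) (G k) &
      forall j : 'I_K, (k <= j)%N ->
        mcvg (fun N => cross_cov (xi N k) (nz N (Some (inl j)))) 0 /\
        mcvg (fun N => cross_cov (xi N k) (nz N (Some (inr j)))) 0].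
Proof.
elim: k => [_|k IH kK].
  split; [exact: (@noise_mean_cvg None)|exact: (@noise_cov_cvg None)|].
  move=> j _; split.
    exact: (@noise_cross_cov_cvg None (Some (inl j))).
  exact: (@noise_cross_cov_cvg None (Some (inr j))).
have [mk Gk xk] := IH (ltnW kK); pose jk := Ordinal kK.
have [xkw xkv] := xk jk (leqnn k).
(* Symmetry is inherited from the sample covariances. *)
have Gs : (G k)^T = G k.
  apply: mcvg_unique (mcvgT Gk) _.
  by apply: eq_mcvg Gk => N; exact/esym/(cross_covT (xi N k) (xi N k)).
pose H N := gain (sample_cov (xi N k)) *m obs_sd M.
pose F N := trans (sample_cov (xi N k)).
have gaink : mcvg (fun N => gain (sample_cov (xi N k))) (gain (G k)).
  by apply: mcvgM; [apply: mcvgM => //; exact: mcvg_cst|exact: mcvg_cst].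
have Hk : mcvg H (gain (G k) *m obs_sd M) by apply: mcvgM => //; exact: mcvg_cst.
have Fk : mcvg F (trans (G k)).
  apply: mcvgD; first exact: mcvg_cst.
  apply: mcvgZ; apply: mcvgB; first exact: mcvg_cst.
  by apply: mcvgM => //; exact: mcvg_cst.
have step N : xi N k.+1 = (fun i => F N *m xi N k i
    + sig_sd M *m nz N (Some (inl jk)) i - H N *m nz N (Some (inr jk)) i
    + gain (sample_cov (xi N k)) *m incr l y k).
  by apply/funext => i; rewrite enkbf_step.
have cc p (v : forall N, 'I_N -> 'cV[R]_p) A1 A2 A3 :
    mcvg (fun N => cross_cov (xi N k) (@v N)) A1 ->
    mcvg (fun N => cross_cov (nz N (Some (inl jk))) (@v N)) A2 ->
    mcvg (fun N => cross_cov (nz N (Some (inr jk))) (@v N)) A3 ->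
    mcvg (fun N => cross_cov (xi N k.+1) (@v N))
      (trans (G k) *m A1 + sig_sd M *m A2 - (gain (G k) *m obs_sd M) *m A3).
  move=> h1 h2 h3.
  apply: (eq_mcvg (u := fun N => F N *m cross_cov (xi N k) (@v N)
    + sig_sd M *m cross_cov (nz N (Some (inl jk))) (@v N)
    - H N *m cross_cov (nz N (Some (inr jk))) (@v N))).
    by move=> N; rewrite step cross_cov_affine.
  apply: mcvgB; last exact: mcvgM.
  by apply: mcvgD; apply: mcvgM => //; exact: mcvg_cst.
have sym p q (u : forall N, 'I_N -> 'cV[R]_p) (v : forall N, 'I_N -> 'cV[R]_q) A :
    mcvg (fun N => cross_cov (@u N) (@v N)) A ->
    mcvg (fun N => cross_cov (@v N) (@u N)) A^T.
  by move=> h; apply: eq_mcvg (mcvgT h) => N; exact: cross_covT.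
split.
- rewrite kb_mean_step => a b.
  have sm : mcvg (fun N => F N *m sample_mean (xi N k)
      + sig_sd M *m sample_mean (nz N (Some (inl jk)))
      - H N *m sample_mean (nz N (Some (inr jk)))
      + gain (sample_cov (xi N k)) *m incr l y k)
    (trans (G k) *m m k + sig_sd M *m 0 - (gain (G k) *m obs_sd M) *m 0
      + gain (G k) *m incr l y k).
    apply: mcvgD; last by apply: mcvgM => //; exact: mcvg_cst.
    apply: mcvgB; last by apply: mcvgM => //; exact: (@noise_mean_cvg (Some (inr jk))).
    apply: mcvgD; first exact: mcvgM.
    by apply: mcvgM; [exact: mcvg_cst|exact: (@noise_mean_cvg (Some (inl jk)))].
  apply: cvg_trans (sm a b); apply: near_eq_cvg; near=> N.
  rewrite step sample_mean_affine//; near: N; exact: nbhs_infty_gt.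
- have c1 : mcvg (fun N => cross_cov (xi N k.+1) (xi N k)) (trans (G k) *m G k).
    have := cc _ _ _ _ _ Gk (sym _ _ _ _ _ xkw) (sym _ _ _ _ _ xkv).
    by rewrite !trmx0 !mulmx0 subr0 addr0.
  have c2 : mcvg (fun N => cross_cov (xi N k.+1) (nz N (Some (inl jk))))
      (sig_sd M *m Dt%:M).
    have := cc _ _ _ _ _ xkw (@noise_cov_cvg (Some (inl jk)))
      (@noise_cross_cov_cvg (Some (inr jk)) (Some (inl jk)) isT).
    by rewrite !mulmx0 subr0 add0r.
  have c3 : mcvg (fun N => cross_cov (xi N k.+1) (nz N (Some (inr jk))))
      (- (gain (G k) *m obs_sd M *m Dt%:M)).
    have := cc _ _ _ _ _ xkv
      (@noise_cross_cov_cvg (Some (inl jk)) (Some (inr jk)) isT)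
      (@noise_cov_cvg (Some (inr jk))).
    by rewrite !mulmx0 !add0r.
  have := cc _ _ _ _ _ (sym _ _ _ _ _ c1) (sym _ _ _ _ _ c2) (sym _ _ _ _ _ c3).
  by rewrite kb_cov_step// trmx_mul Gs mulmxA linearN/= mulmxN opprK.
- move=> j kj.
  have jkj : jk != j by rewrite neq_ltn kj.
  have [h1 h2] := xk j (ltnW kj); split.
    have := cc _ _ _ _ _ h1
      (@noise_cross_cov_cvg (Some (inl jk)) (Some (inl j)) jkj)
      (@noise_cross_cov_cvg (Some (inr jk)) (Some (inl j)) isT).
    by rewrite !mulmx0 subr0 addr0.
  have := cc _ _ _ _ _ h2
    (@noise_cross_cov_cvg (Some (inl jk)) (Some (inr j)) isT)
    (@noise_cross_cov_cvg (Some (inr jk)) (Some (inr j)) jkj).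
  by rewrite !mulmx0 subr0 addr0.
Unshelve. all: by end_near.
Qed.
End enkbf_limit.

(** * Convergence of the estimator *)

Lemma Ubar_cvg (R : realType) (dx dy : nat) (M : lg_params R dx dy) (l n : nat)
    (y : R -> 'cV[R]_dy) (mN : nat -> nat -> 'cV[R]_dx) (m : nat -> 'cV[R]_dx) :
  (forall k, (k < n)%N -> mcvg (fun N => mN N k) (m k)) ->
  (fun N => Ubar M l y (mN N) n) @ \oo --> Ubar M l y m n.
Proof.
move=> h; rewrite /Ubar big_mkord.
rewrite (_ : (fun N => _) = (fun N => \sum_(k < n)
    (dotv (obs M *m mN N k) (obs_cov_inv M *m incr l y k)
     - Delta R l / 2 * dotv (mN N k) (Smx M *m mN N k)))); last first.
  by apply/funext => N; rewrite big_mkord.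
apply: cvg_big => [|k _]; first exact: add_continuous.
have hk := h k (ltn_ord k).
apply: cvgB.
  by apply: cvg_dotv; [apply: mcvgM => //|]; exact: mcvg_cst.
apply: cvgM; first exact: cvg_cst.
by apply: cvg_dotv => //; apply: mcvgM => //; exact: mcvg_cst.
Qed.

Theorem proposition3p1 (R : realType) (d : measure_display)
    (T : measurableType d) (P : probability T R) (dx dy : nat)
    (M : lg_params R dx dy)
    (X : R -> T -> 'cV[R]_dx) (Y : R -> T -> 'cV[R]_dy)
    (W : R -> T -> 'cV[R]_dx) (V : R -> T -> 'cV[R]_dy)
    (xi0 : forall N : nat, 'I_N -> T -> 'cV[R]_dx)
    (Wb : forall N : nat, 'I_N -> R -> T -> 'cV[R]_dx)
    (Vb : forall N : nat, 'I_N -> R -> T -> 'cV[R]_dy)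
    (Hmodel : lg_model P M X Y W V)
    (Hens : forall N : nat, (2 <= N)%N ->
      ensemble_noise P M X Y (xi0 N) (Wb N) (Vb N))
    (Hmu : log_norm (drift M) < 0)
    (Hcov : exists B : R, forall (k l : nat) (j1 j2 : 'I_dx),
      `|kb_cov M l k j1 j2| <= B)
    (l t k1 : nat) (Hk1 : (k1 <= 2 ^ l)%N) :
  {ae P, forall w,
    (fun N : nat =>
       Ubar M l (fun s => Y s w)
         (enkbf_mean M l (fun s => Y s w) (fun i => xi0 N i w)
            (fun i s => Wb N i s w) (fun i s => Vb N i s w))
         (t * 2 ^ l + k1)
       - Ubar M l (fun s => Y s w) (kb_mean M l (fun s => Y s w))
           (t * 2 ^ l + k1))
      @ \oo --> (0 : R)}.
Proof.
set K := (t * 2 ^ l + k1)%N.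
apply: filterS (noise_lln l K Hens) => w [lln1 lln2 lln12].
rewrite -(subrr (Ubar M l (fun s => Y s w) (kb_mean M l (fun s => Y s w)) K)).
apply: cvgB; last exact: cvg_cst.
apply: Ubar_cvg => k kK.
have cross (s s' : source K) : s != s' ->
    mcvg (fun N => cross_cov
      (noise l (fun i => xi0 N i w) (fun i t => Wb N i t w) (fun i t => Vb N i t w) s)
      (noise l (fun i => xi0 N i w) (fun i t => Wb N i t w) (fun i t => Vb N i t w) s')) 0.
  move=> ss'; apply: cross_cov_cvg (lln1 s) (lln1 s') _ => a b.
  by rewrite mxE addr0; exact: lln12.
have [hm _ _] := @enkbf_cvg R dx dy M l K (fun s => Y s w) (fun N i => xi0 N i w)
  (fun N i s => Wb N i s w) (fun N i s => Vb N i s w)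
  (lg_obs_sd_sym Hmodel) (lg_obs_sd_unit Hmodel) (lg_sig_sd_sym Hmodel)
  (fun s => sample_mean_cvg (lln1 s))
  (fun s => cross_cov_cvg (lln1 s) (lln1 s) (lln2 s))
  cross k (ltnW kK).
exact: hm.
Qed.
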